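(* Let $p$ be prime and $k=\overline{\mathbb{F}}_p$. Let $F_1,\ldots,F_m\in k[t][x]$ with $\deg_xF_i>0$ be pairwise non-associate, irreducible and separable over $k(t)$ (not necessarily monic in $x$). Let $F=\prod_iF_i$ and $C$ the affine plane curve $F(t,x)=0$. Let $n\ge3$ with $n>\#\{P\in C(k):m_P>2\}$. Let $\mathbf{f}=\sum_{j=0}^na_jt^j$ with free variables $\mathbf{a}=(a_0,\ldots,a_n)$, and $N_i=\deg_tF_i(t,\mathbf{f})$. Assume $p>\max_iN_i$. Let $L$ be the splitting field of $F(t,\mathbf{f})$ over $k(\mathbf{a})$ and $G=\mathrm{Gal}(L/k(\mathbf{a}))\subseteq S_{N_1}\times\cdots\times S_{N_m}$ (acting on the roots of each $F_i(t,\mathbf{f})$). Then $G=S_{N_1}\times\cdots\times S_{N_m}$.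
   Context: For $P\in C(k)$, its multiplicity $m_P$ is the degree of the lowest-degree nonzero homogeneous form in the Taylor expansion of $F(t,x)$ at $P$. Separable over $k(t)$ means $F_i\notin k[t][x^p]$. *)

(* Defs.v *)
From HB Require Import structures.
From mathcomp Require Import all_boot all_order all_algebra all_fingroup all_field.
Set Implicit Arguments. Unset Strict Implicit. Unset Printing Implicit Defensive.
Import GRing.Theory.
Local Open Scope ring_scope.

(* Elements of k algebraic over the prime field (k = algebraic closure of F_p
   when k is algebraically closed of characteristic p). *)
Definition algebraic_over_prime_field (k : fieldType) : Prop :=
  forall x : k, exists q : {poly k},
    q != 0 /\ (forall i, exists c : nat, q`_i = c%:R) /\ root q x.

(* Bivariate polynomials: {poly {poly k}}, outer variable x, inner variable t.
   F`_i is the coefficient of x^i (a polynomial in t). *)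

Definition irreducible_elt (R : comUnitRingType) (a : R) : Prop :=
  a != 0 /\ a \isn't a GRing.unit /\
  forall b c : R, a = b * c -> b \is a GRing.unit \/ c \is a GRing.unit.

Definition associated (R : comUnitRingType) (a b : R) : Prop :=
  exists2 u : R, u \is a GRing.unit & a = u * b.

(* separable over k(t): F not in k[t][x^p] *)
Definition sep_in_x (k : fieldType) (p : nat) (F : {poly {poly k}}) : Prop :=
  exists i : nat, ~~ (p %| i)%N /\ F`_i != 0.

Definition eval2 (k : fieldType) (F : {poly {poly k}}) (t0 x0 : k) : k :=
  (F.[x0%:P]).[t0].

Definition shift2 (k : fieldType) (F : {poly {poly k}}) (t0 x0 : k)
  : {poly {poly k}} :=
  (map_poly (fun q : {poly k} => q \Po ('X + t0%:P)) F) \Po ('X + (x0%:P)%:P).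

Definition hform_nz (k : fieldType) (G : {poly {poly k}}) (d : nat) : bool :=
  [exists i : 'I_d.+1, (G`_i)`_(d - i) != 0].

Definition tdeg_bound (k : fieldType) (G : {poly {poly k}}) : nat :=
  (\sum_(i < size G) size (nth 0%R G i) + size G)%N.

(* multiplicity m_P of P = (t0, x0): degree of lowest nonzero homogeneous form
   of the Taylor expansion of F at P *)
Definition mult (k : fieldType) (F : {poly {poly k}}) (t0 x0 : k) : nat :=
  let G := shift2 F t0 x0 in find (hform_nz G) (iota 0 (tdeg_bound G)).

(* Iterated rational function field k(a_0)(a_1)...(a_{n-1}) = k(a_0,...,a_{n-1}) *)
Fixpoint ratT (k : fieldType) (n : nat) : fieldType :=
  match n with
  | 0 => k
  | S n' => {fraction {poly ratT k n'}}
  end.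

Definition upr (k : fieldType) (n : nat) (x : ratT k n) : ratT k n.+1 :=
  @FracField.tofrac _ (x%:P).

Fixpoint embk (k : fieldType) (n : nat) : k -> ratT k n :=
  match n return k -> ratT k n with
  | 0 => fun c => c
  | S n' => fun c => upr (embk n' c)
  end.

Fixpoint avar (k : fieldType) (n : nat) (j : nat) : ratT k n :=
  match n return ratT k n with
  | 0 => 0
  | S n' => if j == n' then @FracField.tofrac _ 'X else upr (avar k n' j)
  end.

Definition genpoly (k : fieldType) (n : nat) : {poly ratT k n.+1} :=
  \sum_(j < n.+1) (avar k n.+1 j)%:P * 'X^j.

Definition subst_gen (k : fieldType) (n : nat) (F : {poly {poly k}})
  : {poly ratT k n.+1} :=
  (map_poly (map_poly (@embk k n.+1)) F).[genpoly k n].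

(* Main.v *)
Require Import Defs.
From HB Require Import structures.
From mathcomp Require Import all_boot all_order all_algebra all_fingroup all_field.
From mathcomp Require Import boolp ring.
Import GRing.Theory.
Set Implicit Arguments. Unset Strict Implicit. Unset Printing Implicit Defensive.
Local Open Scope ring_scope.

(** The Galois group [G] is studied through specializations of the coefficients
    [a_j]: a place of [k(a_0, ..., a_n)] is composed of one-variable
    evaluations, and integral elements of [L] fixed by [G] lie in its valuation
    ring, so that [G]-invariant constructions on the roots can be specialized.

    Fix [i] and a point [P = (t0, x0)] of [C_i], with [t0 <> 0], which is a
    simple point of [C] with nonvertical tangent, and let [l(t)] be a polynomial
    of degree [n], with generic leading coefficient, whose graph is tangent to
    [C] at [P]. Specialize [f] to the pencils [l + s (t - t0)^e] over [k(s)].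
    - For [e = 0], [F_j(t, l + s)] is irreducible in [k[t, s]], because it
      arises from [F_j] by a change of variables; hence each [F_j(t, f)] is
      irreducible, and separable as its degree is less than [p].
    - For [e = 1], [F_i(t, l + s (t - t0))] is [t - t0] times an irreducible
      polynomial; hence [G] is doubly transitive on the roots of [F_i(t, f)].
    - For [e = 2], [F(t, l + s (t - t0)^2)] is [(t - t0)^2] times a separable
      polynomial, so for almost all [s = c] the polynomial [f0] obtained meets
      [C] in [P] with multiplicity two and transversally elsewhere. On the line
      [f0 + (a_0 - f0(0))] the value of [F(t0, f)] has a simple zero at
      [a_0 = f0(0)], whereas it would have a double zero if the inertia group
      there were trivial. Inertia can only exchange the two roots specializing
      to [t0], so [G] contains a transposition of two roots of [F_i(t, f)].
    Double transitivity and these transpositions generate the product of the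
    symmetric groups. *)

(** * Places *)

(** A partial homomorphism is encoded by its graph: [R x y] means
    that [x] specializes to [y]. It is a place when its domain is a valuation ring,
    the second alternative below meaning that [x] is sent to infinity. *)
Section Relations.
Variables K K' : fieldType.
Implicit Types R : K -> K' -> Prop.

Definition ring_rel R := [/\ R 1 1,
  forall x y x' y', R x x' -> R y y' -> R (x - y) (x' - y'),
  forall x y x' y', R x x' -> R y y' -> R (x * y) (x' * y') &
  forall y, R 0 y -> y = 0].

Definition place_rel R := ring_rel R /\ forall x, (exists y, R x y) \/ R x^-1 0.

Lemma ring_rel_fun R x y y' : ring_rel R -> R x y -> R x y' -> y = y'.
Proof.
by case=> _ RB _ R0 Rxy Rxy'; apply/eqP; rewrite -subr_eq0; apply/eqP/R0;
   rewrite -(subrr x); apply: RB.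
Qed.

Definition rel_dom R : pred K := fun x => `[< exists y, R x y >].

Lemma rel_dom_closed R : ring_rel R -> subring_closed (rel_dom R).
Proof.
case=> R1 RB RM _; split=> [|x y|x y]; first by apply/asboolP; exists 1.
  by move=> /asboolP[x' Rx] /asboolP[y' Ry]; apply/asboolP; exists (x' - y'); apply: RB.
by move=> /asboolP[x' Rx] /asboolP[y' Ry]; apply/asboolP; exists (x' * y'); apply: RM.
Qed.

End Relations.

Section RelRing.
Variables (K K' : fieldType) (R : K -> K' -> Prop) (hR : ring_rel R).

HB.instance Definition _ := GRing.isSubringClosed.Build K (rel_dom R) (rel_dom_closed hR).

(** The proof is kept as an argument of the type, so that the subring structure, which depends on
    it, can be inferred from the type. *)
Definition rel_ring (_ : ring_rel R) : Type := {x : K | x \in rel_dom R}.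
Local Notation A := (rel_ring hR).
HB.instance Definition _ := SubType.on A.
HB.instance Definition _ := Choice.on A.
HB.instance Definition _ := [SubChoice_isSubComNzRing of A by <:].

Definition rel_sp (a : A) : K' := projT1 (cid (asboolW (valP a))).

Lemma rel_spP (a : A) : R (val a) (rel_sp a).
Proof. by rewrite /rel_sp; case: cid. Qed.

Lemma rel_sp_eq (a : A) y : R (val a) y -> rel_sp a = y.
Proof. exact: ring_rel_fun (rel_spP a). Qed.

Lemma rel_sp_zmod : zmod_morphism rel_sp.
Proof.
move=> a b; apply: rel_sp_eq; rewrite rmorphB; case: hR => _ RB _ _.
by apply: RB; apply: rel_spP.
Qed.

Lemma rel_sp_monoid : monoid_morphism rel_sp.
Proof.
case: hR => R1 _ RM _; split=> [|a b]; first by apply: rel_sp_eq; rewrite rmorph1.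
by apply: rel_sp_eq; rewrite rmorphM; apply: RM; apply: rel_spP.
Qed.

HB.instance Definition _ := GRing.isZmodMorphism.Build A K' rel_sp rel_sp_zmod.
HB.instance Definition _ := GRing.isMonoidMorphism.Build A K' rel_sp rel_sp_monoid.

Section Lift.
Variables (C : comNzRingType) (e : {rmorphism C -> K}) (e' : {rmorphism C -> K'}).
Hypothesis he : forall c, R (e c) (e' c).

Fact rel_lift_proof c : e c \in rel_dom R.
Proof. by apply/asboolP; exists (e' c). Qed.

Definition rel_lift c : A := Sub (e c) (rel_lift_proof c).

Lemma rel_lift_zmod : zmod_morphism rel_lift.
Proof. by move=> a b; apply: val_inj; rewrite /= !rmorphB. Qed.

Lemma rel_lift_monoid : monoid_morphism rel_lift.
Proof.
split=> [|a b]; apply: val_inj; first by rewrite [LHS]/= rmorph1.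
by rewrite [LHS]/= rmorphM.
Qed.
HB.instance Definition _ := GRing.isZmodMorphism.Build C A rel_lift rel_lift_zmod.
HB.instance Definition _ := GRing.isMonoidMorphism.Build C A rel_lift rel_lift_monoid.

Lemma rel_sp_lift c : rel_sp (rel_lift c) = e' c.
Proof. by apply: rel_sp_eq; apply: he. Qed.
End Lift.
End RelRing.

(** From here on a place is handled as a ring [A] with an embedding [i] in [K] and a specialization
    [sp], so that polynomials over [A] can be mapped both ways. The morphism [j] keeps track of the
    constants. *)
Lemma ring_rel_hom (K K' : fieldType) (R : K -> K' -> Prop) (C : comNzRingType)
    (e : {rmorphism C -> K}) (e' : {rmorphism C -> K'}) :
    ring_rel R -> (forall c, R (e c) (e' c)) ->
  exists (A : comNzRingType) (i : {rmorphism A -> K}) (sp : {rmorphism A -> K'})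
         (j : {rmorphism C -> A}),
    [/\ injective i, forall x y, R x y <-> exists2 a, i a = x & sp a = y,
        i \o j =1 e & sp \o j =1 e'].
Proof.
move=> hR he; pose A := rel_ring hR.
exists A, (val : {rmorphism A -> K}), (@rel_sp _ _ _ hR).
exists (@rel_lift _ _ _ hR _ e e' he); split.
- exact: val_inj.
- move=> x y; split=> [Rxy | [a <- <-]]; last exact: rel_spP.
  have xP : x \in rel_dom R by apply/asboolP; exists y.
  by exists (Sub x xP : A); rewrite ?SubK //; apply: rel_sp_eq.
- by [].
- by move=> c; apply: rel_sp_lift.
Qed.

Local Notation tofrac := (@FracField.tofrac _).

Lemma fraction_ex (R : idomainType) (x : {fraction R}) :
  exists n d : R, d != 0 /\ x = tofrac n / tofrac d.
Proof.
elim/quotW: x => r; exists r.1, r.2; split; first exact: denom_ratioP.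
have nz : tofrac r.2 != 0 by rewrite tofrac_eq0 denom_ratioP.
apply: (canRL (mulfK nz)); rewrite /FracField.tofrac; unlock.
rewrite -[LHS](FracField.pi_mul r (Ratio r.2 1)); apply/eqmodP => /=.
rewrite FracField.equivfE /FracField.mulf /= !numden_Ratio ?oner_neq0 ?mulf_neq0 ?oner_neq0 ?denom_ratioP //.
by rewrite !mulr1 mulrC.
Qed.

(** If [x^-1] were sent to infinity, [x] would specialize to 0. Hence [x^-1] has a value, and
    multiplicativity determines it. *)
Lemma place_inv (K K' : fieldType) (R : K -> K' -> Prop) x y :
  place_rel R -> R x y -> y != 0 -> R x^-1 y^-1.
Proof.
move=> [hR Rv] Rxy y0; have [R1 _ RM R0] := hR.
have [[y' Rxy']|] := Rv x^-1; last first.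
  by rewrite invrK => Rx0; rewrite (ring_rel_fun hR Rxy Rx0) eqxx in y0.
have x0 : x != 0 by apply: contraNneq y0 => x0; apply/eqP/R0; rewrite -x0.
have := RM _ _ _ _ Rxy Rxy'; rewrite divff // => Ryy'.
by rewrite -[y^-1]mulr1 -(ring_rel_fun hR Ryy' R1) mulKf.
Qed.

(** The new case is an [x] of value [y] with [y] sent to infinity by [S]: then [x^-1] has the value
    [y^-1], which [S] sends to 0. *)
Lemma place_comp (K1 K2 K3 : fieldType) (R : K1 -> K2 -> Prop) (S : K2 -> K3 -> Prop) :
  place_rel R -> place_rel S -> place_rel (fun x z => exists2 y, R x y & S y z).
Proof.
move=> [[R1 RB RM R0] Rv] [[S1 SB SM S0] Sv].
have R00 : R 0 0 by have := RB _ _ _ _ R1 R1; rewrite !subrr.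
have S00 : S 0 0 by have := SB _ _ _ _ S1 S1; rewrite !subrr.
split; first split.
- by exists 1.
- move=> x y x' y' [u Rxu Sux] [v Rv' Svy]; exists (u - v); [exact: RB|exact: SB].
- move=> x y x' y' [u Rxu Sux] [v Rv' Svy]; exists (u * v); [exact: RM|exact: SM].
- by move=> z [y /R0 -> /S0].
move=> x; have [[y Rxy]|Rx] := Rv x; last by right; exists 0.
have [[z Syz]|Sy] := Sv y; first by left; exists z, y.
have [y0|y0] := eqVneq y 0.
  by left; exists 0, 0; rewrite // -y0.
right; exists y^-1 => //.
by apply: (place_inv (conj (And4 R1 RB RM R0) Rv)).
Qed.

(** The place of the rational function field at [al]; its domain is the local ring at [al]. *)
Definition spec_rel (K0 : fieldType) (al : K0) (x : {fraction {poly K0}}) (y : K0) :=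
  exists N D : {poly K0}, [/\ D.[al] != 0, x = tofrac N / tofrac D & y = N.[al] / D.[al]].

Lemma spec_rel_tofrac (K0 : fieldType) (al : K0) (N : {poly K0}) :
  spec_rel al (tofrac N) N.[al].
Proof. by exists N, 1; rewrite hornerC oner_neq0 rmorph1 !divr1. Qed.

Lemma spec_rel_place (K0 : fieldType) (al : K0) : place_rel (@spec_rel K0 al).
Proof.
have nzF (D : {poly K0}) : D.[al] != 0 -> tofrac D != 0.
  by move=> D0; rewrite tofrac_eq0; apply: contraNneq D0 => ->; rewrite horner0.
split; first split.
- by have := spec_rel_tofrac al 1; rewrite rmorph1 hornerC.
- move=> x y x' y' [N [D [D0 -> ->]]] [N' [D' [D'0 -> ->]]].
  exists (N * D' - N' * D), (D * D'); split; first by rewrite hornerM mulf_neq0.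
    by rewrite rmorphB !rmorphM -[- (tofrac N' / _)]mulNr addf_div ?nzF // mulNr.
  by rewrite hornerD hornerN !hornerM -[- (N'.[al] / _)]mulNr addf_div // mulNr.
- move=> x y x' y' [N [D [D0 -> ->]]] [N' [D' [D'0 -> ->]]].
  exists (N * N'), (D * D'); split; first by rewrite hornerM mulf_neq0.
    by rewrite !rmorphM mulf_div.
  by rewrite !hornerM mulf_div.
- move=> y [N [D [D0 /esym/eqP xE ->]]]; move: xE.
  rewrite mulf_eq0 invr_eq0 (negPf (nzF _ D0)) orbF tofrac_eq0 => /eqP ->.
  by rewrite horner0 mul0r.
move=> x; have [N [D [D0 ->]]] := fraction_ex x.
(* In lowest terms numerator and denominator do not both vanish at [al], so the fraction or its
   inverse has a value there. *)
have [g gN gD] : exists2 g, g * (N %/ gcdp N D) = N & g * (D %/ gcdp N D) = D.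
  by exists (gcdp N D); rewrite mulrC divpK ?dvdp_gcdl ?dvdp_gcdr.
have := @coprimep_div_gcd _ N D; rewrite D0 orbT => /(_ isT).
move: (N %/ _) (D %/ _) gN gD => N1 D1 gN gD cop.
have g0 : tofrac g != 0 by rewrite tofrac_eq0; apply: contraNneq D0 => g0; rewrite -gD g0 mul0r.
have xE : tofrac N / tofrac D = tofrac N1 / tofrac D1.
  by rewrite -gN -gD !rmorphM -mulf_div divff // mul1r.
rewrite xE; have [D10|D10] := eqVneq D1.[al] 0; last first.
  by left; exists (N1.[al] / D1.[al]), N1, D1.
right; exists D1, N1; rewrite D10 mul0r invf_div; split=> //.
by apply: (coprimep_root (p := D1)); rewrite 1?coprimep_sym // /root D10.
Qed.

(** * Places of the tower of rational function fields *)

Section Emb.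
Variable k : fieldType.

Lemma upr_zmod n : zmod_morphism (@upr k n).
Proof. by move=> a b; rewrite /upr polyCB rmorphB. Qed.
Lemma upr_monoid n : monoid_morphism (@upr k n).
Proof. by split=> [|a b]; rewrite /upr ?rmorph1 // polyCM rmorphM. Qed.
HB.instance Definition _ n := GRing.isZmodMorphism.Build _ _ (@upr k n) (@upr_zmod n).
HB.instance Definition _ n := GRing.isMonoidMorphism.Build _ _ (@upr k n) (@upr_monoid n).

Lemma embk_zmod n : zmod_morphism (@embk k n).
Proof. by elim: n => [|n IH] a b //=; rewrite IH rmorphB. Qed.
Lemma embk_monoid n : monoid_morphism (@embk k n).
Proof.
elim: n => [|n [IH1 IHM]]; split=> [|a b] //=; first by rewrite IH1 rmorph1.
by rewrite IHM rmorphM.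
Qed.
HB.instance Definition _ n := GRing.isZmodMorphism.Build k (ratT k n) (@embk k n) (@embk_zmod n).
HB.instance Definition _ n := GRing.isMonoidMorphism.Build k (ratT k n) (@embk k n) (@embk_monoid n).

(** The last variable of the tower is evaluated first, at a preimage [b] of its intended value under
    the place already built. This is why surjectivity is part of the induction. The variable [a_0]
    survives as the parameter of the target field. *)
Lemma tower_place (al : nat -> ratT k 1) n : al 0%N = avar k 1 0 ->
  exists R : ratT k n.+1 -> ratT k 1 -> Prop,
    [/\ place_rel R, forall y, exists x, R x y,
        forall c, R (embk n.+1 c) (embk 1 c) &
        forall j, (j <= n)%N -> R (avar k n.+1 j) (al j)].
Proof.
move=> al0; elim: n => [|n [R [Rp Rsurj Re Ra]]].
  exists eq; split=> //; last by move=> j; rewrite leqn0 => /eqP ->.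
  - split; last by left; exists x.
    by split=> // x y x' y' -> ->.
  - by move=> y; exists y.
have [b Rb] := Rsurj (al n.+1).
exists (fun x z => exists2 y, @spec_rel (ratT k n.+1) b x y & R y z); split.
- exact: place_comp (spec_rel_place _) Rp.
- move=> y; have [x Rxy] := Rsurj y; exists (tofrac x%:P), x => //.
  by have := spec_rel_tofrac b x%:P; rewrite hornerC.
- move=> c; exists (embk n.+1 c); last exact: Re.
  by have := spec_rel_tofrac b (embk n.+1 c)%:P; rewrite hornerC.
move=> j; rewrite leq_eqVlt => /orP[/eqP ->|jn].
  exists b => //; have := spec_rel_tofrac b 'X; rewrite hornerX.
  by rewrite [avar _ _ _]/= eqxx.
exists (avar k n.+1 j); last exact: Ra.
have := spec_rel_tofrac b (avar k n.+1 j)%:P; rewrite hornerC.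
by rewrite [avar _ n.+2 _]/= ltn_eqF.
Qed.
End Emb.

(** * Integral elements over a valuation ring *)

Lemma poly_lift (A B : nzRingType) (f : {rmorphism A -> B}) (P : {poly B}) :
  (forall j, exists a, f a = P`_j) -> exists Q : {poly A}, map_poly f Q = P.
Proof.
move=> /choice[g gP]; exists (\poly_(j < size P) g j); apply/polyP => j.
rewrite coef_map coef_poly; case: ltnP => [_|hj]; first exact: gP.
by rewrite raddf0 nth_default.
Qed.

Lemma size_map_monic (A B : nzRingType) (f : {rmorphism A -> B}) (P : {poly A}) :
  P \is monic -> size (map_poly f P) = size P.
Proof. by move=> Pm; rewrite size_map_poly_id0 // (eqP Pm) rmorph1 oner_neq0. Qed.

Section Valuation.
Variables (A : comNzRingType) (K K' : fieldType) (i : {rmorphism A -> K})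
  (sp : {rmorphism A -> K'}).
Hypotheses (i_inj : injective i)
  (i_val : forall x, (exists a, i a = x) \/ (exists2 a, i a = x^-1 & sp a = 0)).

Variable L : splittingFieldType K.
Local Notation iL := (in_alg L \o i).
Local Notation int := (integralOver iL).

Lemma iL_inj : injective iL.
Proof. by move=> a b /= /(fmorph_inj (in_alg L)); apply: i_inj. Qed.

(** A valuation ring is integrally closed: if [x^-1] comes from an [a] of residue 0, the monic
    equation of [x] multiplied by [a ^+ r] specializes to [1 = 0]. *)
Lemma val_int_closed (x : K) : int x%:A -> exists a, i a = x.
Proof.
case=> p p_mon; rewrite map_poly_comp (fmorph_root (in_alg L)) => px0.
have [//|[a ia sa]] := i_val x.
have [x0|x0] := eqVneq x 0; first by exists 0; rewrite rmorph0 x0.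
have p0 : p != 0 by rewrite monic_neq0.
pose r := (size p).-1.
have sz : size p = r.+1 by rewrite prednK // lt0n size_poly_eq0.
pose q := \sum_(j < r.+1) p`_j * a ^+ (r - j).
have q0 : q = 0.
  apply: i_inj; rewrite rmorph0 rmorph_sum /=.
  transitivity (i a ^+ r * (map_poly i p).[x]); last by rewrite (eqP px0) mulr0.
  rewrite horner_coef size_map_poly_id0 ?sz; last first.
    by rewrite (eqP p_mon) rmorph1 oner_neq0.
  rewrite big_distrr; apply: eq_bigr => j _ /=.
  rewrite coef_map rmorphM rmorphXn /= mulrCA; congr (_ * _).
  have jr : (j <= r)%N by rewrite -ltnS.
  by rewrite -[X in _ = i a ^+ X * _](subnK jr) exprD -mulrA -exprMn ia mulVf // expr1n mulr1.
have := congr1 sp q0; rewrite rmorph0 rmorph_sum big_ord_recr /= subnn expr0 mulr1.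
rewrite -[r]/(size p).-1 -/(lead_coef p) (eqP p_mon) rmorph1 big1 ?add0r.
  by move/eqP; rewrite oner_eq0.
by move=> j _; rewrite rmorphM rmorphXn /= sa expr0n subn_eq0 leqNgt ltn_ord mulr0.
Qed.

Lemma val_poly_int (P : {poly K}) :
  (forall j, int (P`_j)%:A) -> exists Q, map_poly i Q = P.
Proof. by move=> Pint; apply: poly_lift => j; apply: val_int_closed. Qed.

Lemma int_root (Phi : {poly A}) x : Phi \is monic -> root (map_poly iL Phi) x -> int x.
Proof. by exists Phi. Qed.

Lemma int_sum (I : finType) (P : pred I) (f : I -> L) :
  (forall j, P j -> int (f j)) -> int (\sum_(j | P j) f j).
Proof.
move=> h; apply: (big_ind int) => //; first exact: integral0.
exact: integral_add.
Qed.

Lemma int_prod (I : Type) (s : seq I) (P : pred I) (f : I -> L) :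
  (forall j, P j -> int (f j)) -> int (\prod_(j <- s | P j) f j).
Proof.
move=> h; apply: (big_ind int) => //; first exact: integral1.
exact: integral_mul.
Qed.

Definition intp (P : {poly L}) := forall j, int P`_j.

Lemma intpM P Q : intp P -> intp Q -> intp (P * Q).
Proof. by move=> hP hQ j; rewrite coefM; apply: int_sum => l _; apply: integral_mul. Qed.

Lemma intpXsubC x : int x -> intp ('X - x%:P).
Proof.
move=> hx j; rewrite coefB coefX coefC; apply: integral_sub.
  exact: integral_nat.
by case: ifP => // _; apply: integral0.
Qed.

Lemma intp1 : intp 1.
Proof. by move=> j; rewrite coef1; apply: integral_nat. Qed.

Lemma intp_prod_XsubC (I : eqType) (s : seq I) (P : pred I) (f : I -> L) :
  (forall j, j \in s -> P j -> int (f j)) -> intp (\prod_(j <- s | P j) ('X - (f j)%:P)).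
Proof.
move=> h; rewrite big_seq_cond; apply: (big_ind intp) => //.
- exact: intp1.
- exact: intpM.
- by move=> j /andP[js Pj]; apply/intpXsubC/h.
Qed.

(** Gauss's lemma over the valuation ring: the roots of [Q] are among the integral elements [rs], so
    the coefficients of [Q] are integral. *)
Lemma val_monic_dvd (Phi : {poly A}) (rs : seq L) (Q : {poly K}) :
    Phi \is monic -> map_poly iL Phi = \prod_(x <- rs) ('X - x%:P) ->
    Q \is monic -> Q %| map_poly i Phi ->
  exists QA, map_poly i QA = Q.
Proof.
move=> Phi_mon PhiE Qm.
rewrite -(dvdp_map (in_alg L)) -map_poly_comp PhiE => /dvdp_prod_XsubC[m].
rewrite eqp_monic ?monic_map // ?monic_prod_XsubC // => /eqP QE.
apply: val_poly_int => j; rewrite -[_%:A](coef_map (in_alg L)) QE.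
apply: (intp_prod_XsubC (f := id) (P := xpredT)) => x /mem_mask xr _.
by apply: (int_root Phi_mon); rewrite PhiE root_prod_XsubC.
Qed.

(** A factor made monic and its cofactor both lift to [A]. Monic polynomials keep their degree under
    [sp], so the factorization specializes to one with the same degrees. *)
Lemma irreducible_of_spec (Phi : {poly A}) (rs : seq L) :
    Phi \is monic -> map_poly iL Phi = \prod_(x <- rs) ('X - x%:P) ->
    irreducible_poly (map_poly sp Phi) -> irreducible_poly (map_poly i Phi).
Proof.
move=> Phi_mon PhiE [sz irr]; split; first by move: sz; rewrite !size_map_monic.
move=> Q szQ QPhi.
have Q0 : Q != 0.
  by apply: contraTneq QPhi => ->; rewrite dvd0p monic_neq0 ?monic_map.
pose R := (lead_coef Q)^-1 *: Q.
have RQ : R %= Q by rewrite eqp_scale // invr_eq0 lead_coef_eq0.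
have Rm : R \is monic by rewrite monicE lead_coefZ mulVf // lead_coef_eq0.
have RPhi : R %| map_poly i Phi by rewrite (eqp_dvdl _ RQ).
have [RA RAE] := val_monic_dvd Phi_mon PhiE Rm RPhi.
have RAm : RA \is monic.
  by move: Rm; rewrite -RAE; rewrite !monicE lead_coef_map_inj ?rmorph0 // => /eqP h; apply/eqP/i_inj; rewrite h rmorph1.
pose S := map_poly i Phi %/ R.
have SE : S * R = map_poly i Phi by rewrite divpK.
have Sm : S \is monic.
  by have := monic_map i Phi_mon; rewrite -SE monicMr.
have SPhi : S %| map_poly i Phi by rewrite -SE dvdp_mulr.
have [SA SAE] := val_monic_dvd Phi_mon PhiE Sm SPhi.
have PhiA : Phi = SA * RA.
  by apply: (map_inj_poly i_inj (rmorph0 i)); rewrite rmorphM /= SAE RAE.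
have := irr (map_poly sp RA); rewrite PhiA rmorphM /= dvdp_mull // size_map_monic //.
have szRA : size RA = size Q by rewrite -(eqp_size RQ) -RAE size_map_monic.
rewrite szRA => /(_ szQ isT)/eqp_size; rewrite -rmorphM -PhiA !size_map_monic // szRA => szE.
by rewrite -(dvdp_size_eqp QPhi) size_map_monic // szE.
Qed.

End Valuation.

(** * Double transitivity *)

Section Galois.
Variables (K : fieldType) (L : splittingFieldType K).
Local Notation Gal := ('Gal({:L} / 1)%g).

Lemma gal_fixed_base x : galois 1 {:L} -> (forall g, g \in Gal -> g x = x) ->
  exists c : K, c%:A = x.
Proof.
move=> /galois_fixedField fixE hx.
have : x \in fixedField Gal by apply/fixedFieldP; rewrite ?memvf.
by rewrite fixE => /vlineP[c ->]; exists c.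
Qed.

Lemma gal_root_map (g : gal_of {:L}) (rs : seq L) (P : {poly K}) :
    map_poly (in_alg L) P = \prod_(x <- rs) ('X - x%:P) -> uniq rs ->
  perm_eq (map g rs) rs.
Proof.
move=> PE urs; have gE : map_poly g (map_poly (in_alg L) P) = map_poly (in_alg L) P.
  by rewrite -map_poly_comp; apply: eq_map_poly => c /=; rewrite rmorph_alg.
apply: uniq_perm => //; first by rewrite map_inj_uniq //; apply: fmorph_inj.
have sub x : x \in rs -> g x \in rs.
  by rewrite -!root_prod_XsubC -PE => xr; rewrite -gE fmorph_root.
have [] // := @uniq_min_size _ (map g rs) rs; last by rewrite size_map.
  by rewrite map_inj_uniq //; apply: fmorph_inj.
by move=> _ /mapP[x xr ->]; apply: sub.
Qed.

Section TwoTransitive.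
Variables (A : comNzRingType) (K' : fieldType) (i : {rmorphism A -> K})
  (sp : {rmorphism A -> K'}).
Hypotheses (i_inj : injective i)
  (i_val : forall x, (exists a, i a = x) \/ (exists2 a, i a = x^-1 & sp a = 0)).
Local Notation iL := (in_alg L \o i).
Hypothesis galL : galois 1 {:L}.

(** Invariance puts [x] in the base field, integrality then puts it in the valuation ring. Symmetric
    constructions on the roots become specializable in this way. *)
Lemma gal_int_lift x : integralOver iL x -> (forall g, g \in Gal -> g x = x) ->
  exists a, iL a = x.
Proof.
move=> intx /(gal_fixed_base galL)[c cx].
by have [|a ia] := val_int_closed i_inj i_val (L := L) (x := c); [rewrite cx | exists a; rewrite /= ia].
Qed.

Lemma gal_intp_lift (P : {poly L}) : intp i P ->
  (forall g, g \in Gal -> map_poly g P = P) -> exists Q, map_poly iL Q = P.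
Proof.
move=> hP gP; apply: poly_lift => j; apply: gal_int_lift => // g gG.
by rewrite -{2}(gP g gG) coef_map.
Qed.

Variables (Phi : {poly A}) (rs : seq L).
Hypotheses (Phi_mon : Phi \is monic) (urs : uniq rs)
  (PhiE : map_poly iL Phi = \prod_(x <- rs) ('X - x%:P)).

Let root_int x : x \in rs -> integralOver iL x.
Proof. by move=> xr; apply: (int_root Phi_mon); rewrite PhiE root_prod_XsubC. Qed.

Let gperm (g : gal_of {:L}) : perm_eq (map g rs) rs.
Proof. by apply: (@gal_root_map g rs (map_poly i Phi)); rewrite // -map_poly_comp. Qed.

Let gmem (g : gal_of {:L}) x : (g x \in rs) = (x \in rs).
Proof. by rewrite -(perm_mem (gperm g)) mem_map //; apply: fmorph_inj. Qed.

(** The product of the ['X - z] over the orbit [O] of [x] has coefficients in the base field and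
    divides an irreducible polynomial, so every root lies in the orbit. *)
Lemma gal_transitive x y : irreducible_poly (map_poly i Phi) ->
  x \in rs -> y \in rs -> exists2 g, g \in Gal & g x = y.
Proof.
move=> [_ irr] xr yr; pose O := [seq z <- rs | [exists g in Gal, g x == z]].
have Oinv g : g \in Gal -> perm_eq (map g O) O.
  move=> gG; apply: uniq_perm; rewrite ?filter_uniq // ?map_inj_uniq ?filter_uniq //.
    exact: fmorph_inj.
  move=> z; apply/mapP/idP => [[u]|].
    rewrite !mem_filter => /andP[/existsP[h /andP[hG /eqP <-]] xr'] ->.
    rewrite gmem xr' andbT; apply/existsP; exists (h * g)%g.
    by rewrite groupM // galM ?memvf // eqxx.
  rewrite mem_filter => /andP[/existsP[h /andP[hG /eqP <-]] hr].
  exists ((h * g^-1)%g x); last by rewrite -galM ?memvf // mulgKV.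
  rewrite mem_filter gmem xr andbT; apply/existsP; exists (h * g^-1)%g.
  by rewrite groupM ?groupV // eqxx.
have [|g gG|Q QE] := gal_intp_lift (P := \prod_(z <- O) ('X - z%:P)).
- apply: (intp_prod_XsubC (f := id)) => z; rewrite mem_filter => /andP[_ zr] _.
  exact: root_int.
- rewrite rmorph_prod /=; under eq_bigr do rewrite map_polyXsubC.
  by rewrite -(big_map g xpredT (fun z => 'X - z%:P)) (perm_big _ (Oinv g gG)).
have OE : \prod_(z <- O) ('X - z%:P) %| \prod_(z <- rs) ('X - z%:P).
  by rewrite big_filter [X in _ %| X](bigID (fun z => [exists g in Gal, g x == z])) dvdp_mulr.
have xO : x \in O.
  by rewrite mem_filter xr andbT; apply/existsP; exists 1%g; rewrite group1 gal_id eqxx.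
have sQ : size (map_poly i Q) = (size O).+1.
  by rewrite -(size_map_poly (in_alg L)) -map_poly_comp QE size_prod_XsubC.
have : map_poly i Q %| map_poly i Phi.
  by rewrite -(dvdp_map (in_alg L)) -!map_poly_comp QE PhiE.
move/(irr _); rewrite sQ eqSS size_eq0; case: eqP => [O0|_ /(_ isT)].
  by rewrite O0 in xO.
rewrite -(eqp_map (in_alg L)) -!map_poly_comp QE PhiE => /eqp_root/(_ y).
rewrite !root_prod_XsubC yr mem_filter => /andP[/existsP[g /andP[gG /eqP <-]] _].
by exists g.
Qed.

Let gprod (g : gal_of {:L}) (P P' : pred L) : (forall l, P' (g l) = P l) ->
  map_poly g (\prod_(l <- rs | P l) ('X - l%:P)) = \prod_(l <- rs | P' l) ('X - l%:P).
Proof.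
move=> PP'; rewrite rmorph_prod -[RHS](perm_big _ (gperm g)) big_map.
by apply: eq_big => [l|l _]; rewrite ?PP' //= map_polyXsubC.
Qed.

(* In the outer variable Y and the inner variable T, this is the [G]-invariant
   polynomial with value Phi'(j) * prod_(l | O j l) (T - l) at Y = j *)
Definition orbital_poly (O : rel L) : {poly {poly L}} :=
  \sum_(j <- rs) map_poly polyC (\prod_(l <- rs | l != j) ('X - l%:P)) *
     (\prod_(l <- rs | O j l) ('X - l%:P))%:P.

(** The group permutes the summands because [O] is invariant, and the coefficients are integral. The
    common valency [d] of the relation bounds the degree in [T]. *)
Lemma orbital_poly_lift (O : rel L) d :
    (forall g j l, g \in Gal -> O (g j) (g l) = O j l) ->
    (forall j, j \in rs -> count (O j) rs = d) ->
  exists Q : {poly {poly A}}, map_poly (map_poly iL) Q = orbital_poly O /\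
    forall m, (size (Q`_m)%R <= d.+1)%N.
Proof.
move=> Oinv Od.
have coefE m : (orbital_poly O)`_m = \sum_(j <- rs) (\prod_(l <- rs | l != j) ('X - l%:P))`_m *:
     (\prod_(l <- rs | O j l) ('X - l%:P)).
  rewrite coef_sum; apply: eq_bigr => j _.
  by rewrite coefMC coef_map /= mul_polyC.
have [m|Q QE] := poly_lift (f := map_poly iL) (P := orbital_poly O).
  apply: gal_intp_lift => [|g gG].
    rewrite coefE big_seq; apply: (big_ind (@intp _ _ i L)).
    - by move=> n; rewrite coef0; apply: integral0.
    - by move=> P Q hP hQ n; rewrite coefD; apply: integral_add.
    move=> j jr n; rewrite coefZ; apply: integral_mul.
      by apply: (intp_prod_XsubC (f := id)) => l lr _; apply: root_int.
    by apply: (intp_prod_XsubC (f := id)) => l lr _; apply: root_int.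
  rewrite coefE rmorph_sum /= -[RHS](perm_big _ (gperm g)) big_map.
  apply: eq_bigr => j _; rewrite linearZ /=; congr (_ *: _).
    rewrite -coef_map (gprod (P' := fun l => l != g j)) // => l.
    by rewrite (inj_eq (fmorph_inj _)).
  by apply: gprod => l; rewrite Oinv.
exists Q; split=> // m.
rewrite -(size_map_inj_poly (@iL_inj _ _ i i_inj L) (rmorph0 _)) -coef_map QE coefE.
rewrite big_seq; apply: (big_ind (fun P : {poly L} => size P <= d.+1)%N).
- by rewrite size_poly0.
- by move=> P P' hP hP'; rewrite (leq_trans (size_polyD _ _)) // geq_max hP.
move=> j jr; rewrite (leq_trans (size_scale_leq _ _)) //.
by rewrite -big_filter size_prod_XsubC size_filter Od.
Qed.

(** This is Lagrange interpolation: at [Y = j] the summands of the other roots vanish, and the first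
    factor in the summand of [j] becomes the derivative at [j]. *)
Let orbital_polyE O j : j \in rs -> (orbital_poly O).[j%:P] =
  ((map_poly iL Phi)^`().[j])%:P * \prod_(l <- rs | O j l) ('X - l%:P).
Proof.
move=> jr; rewrite /orbital_poly horner_sum (bigD1_seq j) //= [X in _ + X]big1_seq ?addr0.
  rewrite hornerM hornerC; congr (_ * _); rewrite horner_map /=; congr (_%:P).
  rewrite PhiE (bigD1_seq j) //= derivM derivXsubC mul1r hornerD hornerM.
  by rewrite hornerXsubC subrr mul0r addr0.
move=> l /andP[lj lr]; rewrite hornerM horner_map /=.
suff -> : (\prod_(m <- rs | m != l) ('X - m%:P)).[j] = 0 by rewrite mul0r.
by apply/eqP; rewrite -big_filter -/(root _ _) root_prod_XsubC mem_filter jr eq_sym lj.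
Qed.

(** Let [O] be the orbit of the pair [(x, y)] and [O'] the set of the other pairs of distinct roots.
    At [Y = t0] their orbital polynomials specialize to a factorization of [H], up to a constant,
    into degrees at most [r] and [r']. Irreducibility of [H] forces [r' = 0], so all pairs lie in
    [O]. *)
Lemma gal_two_transitive (t0 : A) (H : {poly K'}) :
    irreducible_poly (map_poly i Phi) ->
    map_poly sp Phi = ('X - (sp t0)%:P) * H -> irreducible_poly H -> H.[sp t0] != 0 ->
  forall x y x' y', x \in rs -> y \in rs -> x' \in rs -> y' \in rs ->
    x != y -> x' != y' -> exists2 g, g \in Gal & g x = x' /\ g y = y'.
Proof.
move=> irrPhi spPhi irrH H0 x y x' y' xr yr x'r y'r xy xy'.
pose O : rel L := fun j l => [exists g in Gal, (g x == j) && (g y == l)].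
pose O' : rel L := fun j l => (j != l) && ~~ O j l.
have ginj (g : gal_of {:L}) : injective g by apply: fmorph_inj.
have OI g j l : g \in Gal -> O (g j) (g l) = O j l.
  move=> gG; apply/existsP/existsP => -[h /and3P[hG /eqP hj /eqP hl]]; last first.
    by exists (h * g)%g; rewrite groupM // !galM ?memvf // hj hl !eqxx.
  exists (h * g^-1)%g; rewrite groupM ?groupV // !galM ?memvf // hj hl.
  by rewrite -!galM ?memvf // mulgV !gal_id !eqxx.
have OI' g j l : g \in Gal -> O' (g j) (g l) = O' j l.
  by move=> gG; rewrite /O' OI // (inj_eq (ginj g)).
have cnt (P : rel L) : (forall g j l, g \in Gal -> P (g j) (g l) = P j l) ->
    forall j, j \in rs -> count (P j) rs = count (P x) rs.
  move=> PI j jr; have [g gG <-] := gal_transitive irrPhi xr jr.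
  rewrite -(seq.permP (gperm g)) count_map.
  by apply: eq_count => l /=; rewrite PI.
have [Q [QE Qsz]] := orbital_poly_lift OI (cnt O OI).
have [R [RE Rsz]] := orbital_poly_lift OI' (cnt O' OI').
set r := count (O x) rs in Qsz; set r' := count (O' x) rs in Rsz.
have Oirr l m : O l m -> m != l.
  case/existsP=> g /and3P[_ /eqP <- /eqP <-].
  by rewrite (inj_eq (ginj g)) eq_sym.
have rr' : (r + r').+1 = size rs.
  rewrite -(count_predC (pred1 x)) -[count (pred1 x) _]/(count_mem x rs).
  rewrite count_uniq_mem // xr add1n; congr _.+1.
  rewrite -count_predUI [X in (_ + X)%N](_ : _ = 0%N) ?addn0.
    apply: eq_count => l /=; rewrite /O' [x == l]eq_sym.
    by case Oxl: (O x l) => //=; rewrite ?andbT // (Oirr _ _ Oxl).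
  by apply/eqP; rewrite -leqn0 leqNgt -has_count; apply/hasPn => l _ /=; rewrite /O'; case: (O x l); rewrite ?andbF.
have szPhi : size Phi = (size rs).+1.
  by rewrite -(size_map_monic iL Phi_mon) PhiE size_prod_XsubC.
(* Here ['X%:P - 'X] is [T - Y]. At [Y = l], for a root [l], the difference [E] vanishes, because
   [O] and [O'] share out the roots other than [l]. *)
pose E := Q * R * ('X%:P - 'X) - map_poly polyC (Phi^`()) * map_poly polyC (Phi^`()) * Phi%:P.
pose PhiY : {poly {poly A}} := map_poly polyC Phi.
have PhiYm : PhiY \is monic by apply: monic_map.
pose mL : {rmorphism {poly A} -> {poly L}} := map_poly iL.
have mLC (P : {poly A}) : map_poly mL (map_poly polyC P) = map_poly polyC (map_poly iL P).
  by rewrite -!map_poly_comp; apply: eq_map_poly => a /=; rewrite map_polyC.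
have EL l : l \in rs -> (map_poly mL E).[l%:P] = 0.
  move=> lr; rewrite /E rmorphB !rmorphM rmorphB /= mLC !map_polyC !map_polyX /=.
  rewrite QE RE hornerD hornerN !hornerM hornerD hornerN hornerX !hornerC.
  rewrite !orbital_polyE // horner_map /= -deriv_map map_polyX.
  set d := ((_^`()).[l])%:P.
  have -> : map_poly iL Phi = ('X - l%:P) * ((\prod_(m <- rs | O l m) ('X - m%:P)) *
      \prod_(m <- rs | O' l m) ('X - m%:P)).
    rewrite PhiE (bigD1_seq l) //=; congr (_ * _).
    rewrite (bigID (O l)) /=; congr (_ * _).
      by apply: eq_bigl => m; case Olm: (O l m); rewrite ?andbF // (Oirr _ _ Olm).
    by apply: eq_bigl => m; rewrite /O' eq_sym.
  by apply/eqP; rewrite subr_eq0; apply/eqP; ring.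
have [S ES] : exists S, E = S * PhiY.
  exists (Pdiv.CommonRing.rdivp E PhiY).
  have := Pdiv.RingMonic.rdivp_eq PhiYm E.
  set rho := Pdiv.CommonRing.rmodp _ _ => Edef.
  suff rho0 : rho = 0 by rewrite {1}Edef rho0 addr0.
  have mL_inj : injective mL.
    by apply: map_inj_poly; [exact: (@iL_inj _ _ i i_inj L) | exact: rmorph0].
  apply: (map_inj_poly mL_inj (rmorph0 _)); rewrite rmorph0.
  (* The remainder has lower degree in [Y] than [Phi], yet it vanishes at all the roots. *)
  apply/eqP/negPn/negP => rho0.
  have := max_poly_roots (rs := map polyC rs) rho0.
  rewrite map_inj_uniq ?urs; last exact: polyC_inj.
  move=> h; have {h} : (size rs < size (map_poly mL rho))%N.
    rewrite -(size_map (@polyC L) rs); apply: h => //.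
    apply/allP => _ /mapP[l lr ->]; rewrite /root.
    have -> : rho = E - Pdiv.CommonRing.rdivp E PhiY * PhiY by rewrite {1}Edef addrC addKr.
    rewrite rmorphB rmorphM /= mLC hornerD hornerN hornerM EL // horner_map /=.
    have : root (map_poly iL Phi) l by rewrite PhiE root_prod_XsubC.
    by move=> /eqP ->; rewrite mulr0 subrr.
  rewrite size_map_inj_poly ?rmorph0 // ltnNge -ltnS -szPhi => /negP; apply.
  have -> : size Phi = size PhiY by rewrite size_map_polyC.
  exact: Pdiv.CommonRing.ltn_rmodpN0 (monic_neq0 PhiYm).
move: (sp t0) spPhi H0 => c spPhi H0.
pose ms : {rmorphism {poly A} -> {poly K'}} := map_poly sp.
have msC (P : {poly A}) : map_poly ms (map_poly polyC P) = map_poly polyC (map_poly sp P).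
  by rewrite -!map_poly_comp; apply: eq_map_poly => a /=; rewrite map_polyC.
(* At [Y = c] the specialized [Phi] vanishes and its derivative equals [H.[c]]. *)
have := congr1 (fun P => (map_poly ms P).[c%:P]) ES.
rewrite /= /E rmorphB !rmorphM rmorphB /= !msC !map_polyC !map_polyX /=.
rewrite hornerD hornerN !hornerM hornerD hornerN hornerX !hornerC !horner_map /=.
rewrite -deriv_map /= spPhi derivM derivXsubC mul1r hornerD !hornerM.
rewrite hornerXsubC subrr !mul0r addr0 mulr0.
set Q0 := _.[c%:P]; set R0 := _.[c%:P] => /eqP; rewrite subr_eq0 => /eqP.
rewrite map_polyX mulrC [RHS]mulrCA => /(mulfI (monic_neq0 (monicXsubC c))) QRH.
have QRH' : Q0 * R0 = (H.[c] * H.[c]) *: H by rewrite QRH -polyCM mul_polyC.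
have szH : size H = (r + r').+1.
  have := size_map_monic sp Phi_mon.
  by rewrite spPhi size_monicM ?monicXsubC ?irredp_neq0 // size_XsubC szPhi rr' => -[].
have u0 : H.[c] * H.[c] != 0 by rewrite mulf_neq0.
have szev (P : {poly {poly A}}) d : (forall m, (size (P`_m)%R <= d.+1)%N) ->
    (size (map_poly ms P).[c%:P] <= d.+1)%N.
  move=> hP; rewrite horner_coef; apply: (big_ind (fun P : {poly K'} => size P <= d.+1)%N).
  - by rewrite size_poly0.
  - by move=> P1 P2 h1 h2; rewrite (leq_trans (size_polyD _ _)) // geq_max h1.
  move=> j _; rewrite -polyC_exp mulrC mul_polyC (leq_trans (size_scale_leq _ _)) //.
  by rewrite coef_map (leq_trans (size_poly _ _)).
have szQ := szev _ _ Qsz; have szR := szev _ _ Rsz.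
rewrite -/Q0 in szQ; rewrite -/R0 in szR.
have QR0 : Q0 * R0 != 0 by rewrite QRH' scaler_eq0 (negPf u0) irredp_neq0.
have Q00 : Q0 != 0 by apply: contraNneq QR0 => ->; rewrite mul0r.
have R00 : R0 != 0 by apply: contraNneq QR0 => ->; rewrite mulr0.
have szQR : (size Q0 + size R0 = (r + r').+2)%N.
  have := size_mul Q00 R00; rewrite QRH' size_scale // szH.
  have : (0 < size Q0)%N by rewrite size_poly_gt0.
  by case: (size Q0) => // n _; rewrite addSn /= => ->.
have r0 : (0 < r)%N.
  rewrite -has_count; apply/hasP; exists y => //; apply/existsP; exists 1%g.
  by rewrite group1 !gal_id !eqxx.
have Qdvd : Q0 %| H by rewrite -(dvdpZr _ _ u0) -QRH' dvdp_mulr.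
(* The degree bounds [r] and [r'] add up to the degree of [H], so both are attained; in particular
   [Q0] is not constant. *)
have szQe : size Q0 = r.+1 by apply/eqP; rewrite eqn_leq szQ -(leq_add2r (size R0)) szQR addSn !ltnS -addnS leq_add2l.
have := irrH.2 Q0; rewrite szQe eqSS -lt0n r0 => /(_ isT Qdvd)/eqp_size.
rewrite szQe szH => rE; have r'0 : r' = 0%N by apply/eqP; rewrite -(eqn_add2l r) addn0 -eqSS -rE.
have : count (O' x') rs = 0%N by rewrite (cnt O' OI').
move/eqP; rewrite -leqn0 leqNgt -has_count => /hasPn/(_ y' y'r).
by rewrite /O' xy' negbK => /existsP[g /and3P[gG /eqP gx /eqP gy]]; exists g.
Qed.
End TwoTransitive.
End Galois.

(** * Inertia *)

Section Extension.
Variables (K : fieldType) (L : splittingFieldType K) (k : closedFieldType)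
  (A : comNzRingType) (i : {rmorphism A -> K}) (sp : {rmorphism A -> k}) (pi : A).
Hypotheses (i_inj : injective i)
  (i_val : forall x, (exists a, i a = x) \/ (exists2 a, i a = x^-1 & sp a = 0))
  (sp_surj : forall z, exists a, sp a = z)
  (sp_pi : sp pi = 0) (sp_ker : forall a, sp a = 0 -> exists b, a = pi * b).
Local Notation iL := (in_alg L \o i).
Local Notation int := (integralOver iL).

(** An ideal of the integral closure of [A] in [L], as a predicate on [L]. Instead of a maximal
    ideal, one just large enough to give the finitely many roots a residue in [k] is built below. *)
Definition proper_ideal (I : L -> Prop) :=
  [/\ forall x, I x -> int x, forall x y, I x -> I y -> I (x + y),
      forall b x, int b -> I x -> I (b * x), I (iL pi) & ~ I 1].

(** Were 1 a multiple of [pi], the inverse of [pi] would be integral, hence in the valuation ring,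
    against [sp pi = 0]. *)
Lemma proper_ideal_base : proper_ideal (fun x => exists2 b, int b & x = iL pi * b).
Proof.
split.
- by move=> x [b hb ->]; apply: integral_mul => //; apply: integral_id.
- by move=> x y [b hb ->] [c hc ->]; exists (b + c); [apply: integral_add | rewrite mulrDr].
- by move=> b x hb [c hc ->]; exists (b * c); [apply: integral_mul | rewrite mulrCA].
- by exists 1; [apply: integral1 | rewrite mulr1].
case=> b hb /esym piE.
have pi0 : i pi != 0.
  apply/eqP => pi0; move/eqP: piE; rewrite /= pi0 scale0r mul0r.
  by rewrite eq_sym oner_eq0.
have bE : b = ((i pi)^-1)%:A.
  apply: (@mulfI _ (i pi)%:A); first by rewrite scaler_eq0 oner_eq0 orbF.
  by rewrite piE -[_ * _](rmorphM (in_alg L)) divff //= scale1r.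
have [|a ia] := val_int_closed i_inj i_val (L := L) (x := (i pi)^-1); first by rewrite -bE.
have : pi * a = 1.
  by apply: i_inj; rewrite rmorphM rmorph1 ia divff.
by move/(congr1 sp)/eqP; rewrite rmorphM rmorph1 sp_pi mul0r eq_sym oner_eq0.
Qed.

(* The product of the [t - z], for [z] lifting the roots of the specialized
   polynomial, lies in [I], so some [t - z] is not invertible modulo [I]. *)
Lemma proper_ideal_step (Phi : {poly A}) I t : Phi \is monic -> proper_ideal I ->
    root (map_poly iL Phi) t ->
  exists I' z, [/\ proper_ideal I', forall x, I x -> I' x & I' (t - iL z)].
Proof.
move=> Phim [Iint ID IM Ipi I1] rt.
have t_int : int t by apply: (int_root Phim).
have I0 : I 0 by rewrite -(mul0r (iL pi)); apply: IM => //; apply: integral0.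
have [zs zsE] : exists zs : seq A, map_poly sp Phi = \prod_(z <- zs) ('X - (sp z)%:P).
  have [s sE] := closed_field_poly_normal (map_poly sp Phi).
  have [lf lfP] := choice sp_surj; exists (map lf s).
  rewrite sE (eqP (monic_map sp Phim)) scale1r big_map.
  by apply: eq_bigr => z _; rewrite lfP.
(* The product of the ['X - z] agrees with [Phi] modulo [pi], and [t] is a root of [Phi]. *)
have prodI : I (\prod_(z <- zs) (t - iL z)).
  pose D := Phi - \prod_(z <- zs) ('X - z%:P).
  have D0 j : exists b, D`_j = pi * b.
    apply: sp_ker; rewrite -coef_map rmorphB /= zsE rmorph_prod /=.
    under [X in _ - X]eq_bigr do rewrite map_polyXsubC.
    by rewrite subrr coef0.
  have -> : \prod_(z <- zs) (t - iL z) = - (map_poly iL D).[t].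
    rewrite rmorphB hornerD hornerN (eqP rt) sub0r opprK rmorph_prod horner_prod.
    by apply: eq_bigr => z _; rewrite /= map_polyXsubC hornerXsubC.
  rewrite -mulN1r; apply: (IM); first exact/integral_opp/integral1.
  rewrite horner_coef; apply: (big_ind I) => // j _.
  have [b Db] := D0 j; have -> : (map_poly iL D)`_j * t ^+ j = iL b * t ^+ j * iL pi.
    transitivity (iL (pi * b) * t ^+ j); first by rewrite coef_map Db.
    by rewrite (rmorphM (in_alg L \o i : {rmorphism A -> L})); ring.
  apply: IM => //; apply: integral_mul; first exact: integral_id.
  elim: (nat_of_ord j) => [|n IH]; first exact: integral1.
  by rewrite exprS; apply: integral_mul.
(* That is, [t - iL z] is invertible modulo [I]. *)
pose bad z := exists x b, [/\ I x, int b & 1 = x + (t - iL z) * b].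
have [z zbad] : exists z, ~ bad z.
  apply: contrapT => /forallNP allbad; apply: I1.
  have {allbad} allbad z : bad z by apply: contrapT => /allbad.
  suff : exists x b, [/\ I x, int b & 1 = x + b * \prod_(z <- zs) (t - iL z)].
    by case=> x [b [Ix hb ->]]; apply: ID => //; apply: IM.
  elim: (zs) => [|z s [x [b [Ix hb E]]]].
    by exists 0, 1; split=> //; rewrite ?big_nil ?add0r ?mulr1 //; apply: integral1.
  have [x' [b' [Ix' hb' E']]] := allbad z.
  set P := \prod_(_ <- s) _ in E.
  exists (x + (b * P) * x'), (b * b'); split.
  - apply: ID => //; apply: IM => //; apply: integral_mul => //.
    apply: int_prod => y _; apply: integral_sub => //; exact: integral_id.
  - exact: integral_mul.
  rewrite big_cons -/P.
  transitivity (x + b * P * (x' + (t - iL z) * b')); first by rewrite -E' mulr1.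
  ring.
(* The ideal generated by [I] and [t - iL z]. *)
exists (fun y => exists x b, [/\ I x, int b & y = x + (t - iL z) * b]), z.
have tz : int (t - iL z) by apply: integral_sub => //; apply: integral_id.
split; last 1 first.
- by exists 0, 1; split=> //; rewrite ?add0r ?mulr1 //; apply: integral1.
- split=> //.
  + move=> _ [x [b [Ix hb ->]]]; apply: integral_add; first exact: Iint.
    exact: integral_mul.
  + move=> _ _ [x [b [Ix hb ->]]] [y [c [Iy hc ->]]]; exists (x + y), (b + c).
    by split; [exact: ID | exact: integral_add | ring].
  + move=> c _ hc [x [b [Ix hb ->]]]; exists (c * x), (c * b).
    by split; [exact: IM | exact: integral_mul | ring].
  + by exists (iL pi), 0; split=> //; rewrite ?mulr0 ?addr0 //; apply: integral0.
by move=> x Ix; exists x, 0; split=> //; rewrite ?mulr0 ?addr0 //; apply: integral0.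
Qed.

Lemma proper_ideal_roots (Phi : {poly A}) (rs : seq L) : Phi \is monic ->
    (forall t, t \in rs -> root (map_poly iL Phi) t) ->
  exists2 I, proper_ideal I & forall t, t \in rs -> exists z, I (t - iL z).
Proof.
move=> Phim; elim: rs => [|t rs IH] hrs.
  by exists (fun x => exists2 b, int b & x = iL pi * b); first exact: proper_ideal_base.
have [|I PI HI] := IH; first by move=> u ur; apply: hrs; rewrite inE ur orbT.
have [|I' [z [PI' II' zt]]] := @proper_ideal_step Phi I t Phim PI; first by apply: hrs; rewrite mem_head.
exists I' => // u; rewrite inE => /predU1P[->|/HI[y /II' h]]; last by exists y.
by exists z.
Qed.

(** The ring [B] consists of the integral elements congruent modulo [I] to an element of [A], and
    [phi] takes the residue of that element. The residue is well defined since an element of [A]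
    with nonzero residue is invertible and so cannot lie in [I]. *)
Lemma residue_extension (Phi : {poly A}) (rs : seq L) : Phi \is monic ->
    (forall t, t \in rs -> root (map_poly iL Phi) t) ->
  exists (B : comNzRingType) (j : {rmorphism B -> L}) (phi : {rmorphism B -> k})
         (eta : {rmorphism A -> B}),
    [/\ injective j, j \o eta =1 iL, phi \o eta =1 sp, forall b, int (j b) &
        forall t, t \in rs -> exists b, j b = t].
Proof.
move=> Phim hrs; have [I [Iint ID IM Ipi I1] HI] := proper_ideal_roots Phim hrs.
have IB x y : I x -> I y -> I (x - y).
  move=> Ix Iy; apply: ID => //; rewrite -mulN1r; apply: IM => //.
  exact/integral_opp/integral1.
have I0 : I 0 by rewrite -(subrr (iL pi)); apply: IB.
have IA a : I (iL a) -> sp a = 0.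
  move=> Ia; have [[b ib]|[b ib sb]] := i_val (i a)^-1; last first.
    by rewrite -sb; congr (sp _); apply: i_inj; rewrite ib invrK.
  apply: contrapT => sa; apply: I1; have ia0 : i a != 0.
    by apply: contra_not_neq sa => ia0; rewrite -(rmorph0 sp); congr (sp _); apply: i_inj; rewrite ia0 rmorph0.
  have -> : 1 = iL b * iL a.
    by rewrite -rmorphM /= rmorphM ib mulVf // scale1r.
  by apply: IM => //; apply: integral_id.
pose S (b : L) y := int b /\ exists2 a, I (b - iL a) & sp a = y.
have S_ring : ring_rel S.
  split.
  - by split; [apply: integral1 | exists 1; rewrite ?rmorph1 ?subrr].
  - move=> x y x' y' [hx [a Ia <-]] [hy [b Ib <-]]; split; first exact: integral_sub.
    exists (a - b); rewrite ?rmorphB //.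
    have -> : x - y - (iL a - iL b) = (x - iL a) - (y - iL b) by ring.
    exact: IB.
  - move=> x y x' y' [hx [a Ia <-]] [hy [b Ib <-]]; split; first exact: integral_mul.
    exists (a * b); rewrite ?rmorphM //.
    have -> : x * y - (iL a * iL b) = x * (y - iL b) + iL b * (x - iL a) by ring.
    by apply: ID; apply: IM => //; apply: integral_id.
  - move=> y [_ [a Ia <-]]; apply: IA; have -> : iL a = -1 * (0 - iL a) by rewrite sub0r mulrNN mul1r.
    by apply: IM => //; apply/integral_opp/integral1.
have S_A a : S (iL a) (sp a).
  by split; [apply: integral_id | exists a; rewrite ?subrr].
have [B [j [phi [eta [jinj SP jeta phieta]]]]] := ring_rel_hom S_ring S_A.
exists B, j, phi, eta; split=> //.
  by move=> b; case: ((SP (j b) (phi b)).2); first by exists b.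
move=> t tr; have [z Itz] := HI t tr.
have [|b jb _] := (SP t (sp z)).1; last by exists b.
by split; [apply: (int_root Phim); apply: hrs | exists z].
Qed.
End Extension.

Lemma uniq_map_inj_in (T1 T2 : eqType) (f : T1 -> T2) (s : seq T1) :
  uniq (map f s) -> {in s &, injective f}.
Proof.
elim: s => //= a s IH /andP[fa us] x y; rewrite !inE.
move=> /predU1P[->|xs] /predU1P[->|ys] // fxy; last exact: IH.
  by move: fa; rewrite fxy map_f.
by move: fa; rewrite -fxy map_f.
Qed.

Section Inertia.
Variables (K : fieldType) (L : splittingFieldType K) (k : closedFieldType)
  (A : comNzRingType) (i : {rmorphism A -> K}) (sp : {rmorphism A -> k}) (pi : A).
Hypotheses (i_inj : injective i)
  (i_val : forall x, (exists a, i a = x) \/ (exists2 a, i a = x^-1 & sp a = 0))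
  (sp_surj : forall z, exists a, sp a = z)
  (sp_pi : sp pi = 0) (sp_ker : forall a, sp a = 0 -> exists b, a = pi * b)
  (pi0 : pi != 0).
Local Notation iL := (in_alg L \o i).
Local Notation int := (integralOver iL).
Local Notation Gal := ('Gal({:L} / 1)%g).
Local Notation G := (gal_of {:L}).
Hypothesis galL : galois 1 {:L}.

Lemma gal_all (g : G) : g \in Gal.
Proof.
rewrite gal_kHom ?sub1v //; apply/kAHomP => x /vlineP[c ->].
by rewrite linearZ /= rmorph1.
Qed.

Section Residue.
Variables (B : comNzRingType) (j : {rmorphism B -> L}) (phi : {rmorphism B -> k})
  (eta : {rmorphism A -> B}).
Hypotheses (j_inj : injective j) (jeta : j \o eta =1 iL) (phieta : phi \o eta =1 sp)
  (j_int : forall b, int (j b)).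

(* [beta g] stands for the conjugate by [g] of an element that is a unit at
   the prime [phi] and lies in every other conjugate of that prime *)
Variable beta : G -> B.
Hypotheses (betaE : forall g, j (beta g) = g (j (beta 1%g)))
  (beta0 : forall g, g != 1%g -> phi (beta g) = 0) (beta1 : phi (beta 1%g) != 0).

(* The matrix with entries [(h^-1 * g) b] sends the column of the conjugates of
   [b * xi] to a column of traces, which are divisible by [pi]; it specializes
   to a nonzero scalar matrix. *)
Lemma unramified_dvd (xi : G -> B) : (forall g, j (xi g) = g (j (xi 1%g))) ->
    phi (xi 1%g) = 0 ->
  exists w b, phi w != 0 /\ w * xi 1%g = eta pi * b.
Proof.
move=> xiE xi0.
have galMj (P : G -> B) : (forall g : G, j (P g) = g (j (P 1%g))) ->
    forall g h : G, h (j (P g)) = j (P (g * h)%g).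
  by move=> PE g h; rewrite [RHS]PE galM ?memvf // -PE.
(* The sum is a trace, so it lies in [A]; its residue is 0, by [xi0] for [g = 1] and by [beta0] for
   the other terms. *)
have trace (h : G) : exists a, eta (pi * a) = \sum_g beta g * xi g * beta (h^-1 * g)%g.
  have [|g _|a ia] := @gal_int_lift _ _ _ _ _ _ i_inj i_val galL
      (j (\sum_g beta g * xi g * beta (h^-1 * g)%g)) => //.
    rewrite [in RHS](reindex_inj (mulIg g)) /= !rmorph_sum.
    by apply: eq_bigr => u _; rewrite !rmorphM /= !galMj // mulgA.
  have aE : eta a = \sum_g beta g * xi g * beta (h^-1 * g)%g.
    by apply: j_inj; rewrite -ia -jeta.
  have [|b ab] := sp_ker (a := a); last by exists b; rewrite -ab.
  rewrite -phieta /= aE rmorph_sum big1 // => g _; rewrite !rmorphM /=.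
  have [->|g1] := eqVneq g 1%g; first by rewrite xi0 mulr0 mul0r.
  by rewrite beta0 // !mul0r.
have [a aE] := choice trace.
pose n := #|{: G}|; pose e (p : 'I_n) : G := enum_val p.
pose M : 'M[B]_n := \matrix_(p, q) beta ((e p)^-1 * e q)%g.
pose v : 'cV[B]_n := \col_q (beta (e q) * xi (e q)).
pose s : 'cV[B]_n := \col_p (eta (a (e p))).
have Mv : M *m v = eta pi *: s.
  apply/colP => p; rewrite !mxE -rmorphM aE.
  rewrite [RHS](reindex e) /=; last exact/onW_bij/enum_val_bij.
  by apply: eq_bigr => q _; rewrite !mxE mulrC.
(* Multiplication by the adjugate makes the entries of [v], up to the determinant, divisible by
   [pi]. *)
have detv : \det M *: v = eta pi *: (\adj M *m s).
  by rewrite scalemxAr -Mv mulmxA mul_adj_mx mul_scalar_mx.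
have phidet : phi (\det M) != 0.
  rewrite -det_map_mx.
  have -> : map_mx phi M = (phi (beta 1%g))%:M.
    apply/matrixP => p q; rewrite !mxE; have [->|pq] := eqVneq p q.
      by rewrite mulVg mulr1n.
    rewrite beta0 ?mulr0n // -eq_invg_mul invgK.
    by apply: contraNneq pq => /enum_val_inj ->.
  by rewrite det_scalar expf_neq0.
pose p1 : 'I_n := enum_rank (1%g : G).
exists (\det M * beta 1%g), ((\adj M *m s) p1 0); split.
  by rewrite rmorphM mulf_neq0.
have := congr1 (fun V : 'cV[B]_n => V p1 0) detv.
by rewrite !mxE /e enum_rankK mulrA.
Qed.
End Residue.

Variables (Phi : {poly A}) (rs : seq L).
Hypotheses (Phi_mon : Phi \is monic) (urs : uniq rs)
  (PhiE : map_poly iL Phi = \prod_(x <- rs) ('X - x%:P))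
  (rs_gen : forall g : G, (forall x, x \in rs -> g x = x) -> g = 1%g).

(** The residues of the roots are distinct, except that two roots [x1] and [x2] lie over [sp t0]; a
    nontrivial element preserving residues must exchange these two. Were there none, [pi] would
    divide both [t0 - x1] and [t0 - x2], up to factors with nonzero residue, and so would divide
    [Phi.[t0]] twice. *)
Lemma inertia_transposition (t0 d : A) (Psi : {poly k}) :
    Phi.[t0] = pi * d -> sp d != 0 ->
    map_poly sp Phi = ('X - (sp t0)%:P) * ('X - (sp t0)%:P) * Psi ->
    separable_poly Psi -> Psi.[sp t0] != 0 ->
  exists x1 x2 (g : G), [/\ [/\ x1 \in rs, x2 \in rs & x1 != x2],
    g x1 = x2 /\ g x2 = x1,
    forall x, x \in rs -> x != x1 -> x != x2 -> g x = x &
    forall P : {poly A}, root (map_poly iL P) x1 -> root (map_poly sp P) (sp t0)].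
Proof.
move=> Phit0 d0 PhiS sepPsi Psi0.
have rootrs t : t \in rs -> root (map_poly iL Phi) t by rewrite PhiE root_prod_XsubC.
have [B [j [phi [eta [j_inj jeta phieta j_int jrs]]]]] :=
  residue_extension i_inj i_val sp_surj sp_pi sp_ker Phi_mon rootrs.
have [t tP] : exists t : L -> B, forall x, x \in rs -> j (t x) = x.
  suff /choice[t tP] : forall x, exists b, x \in rs -> j b = x by exists t.
  by move=> x; have [/jrs[b jb]|] := boolP (x \in rs); [exists b | exists 0].
pose zf x := phi (t x); set c := sp t0 in PhiS Psi0 *.
have etaPhi : map_poly eta Phi = \prod_(x <- rs) ('X - (t x)%:P).
  apply: (map_inj_poly j_inj (rmorph0 j)).
  rewrite -map_poly_comp (eq_map_poly jeta) PhiE rmorph_prod.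
  by apply: eq_big_seq => x xr; rewrite /= map_polyXsubC tP.
have spPhi : map_poly sp Phi = \prod_(x <- rs) ('X - (zf x)%:P).
  rewrite -(eq_map_poly phieta) map_poly_comp etaPhi rmorph_prod.
  by apply: eq_bigr => x _; rewrite /= map_polyXsubC.
have gmem (g : G) x : x \in rs -> g x \in rs.
  move=> xr; have PhiE' : map_poly (in_alg L) (map_poly i Phi) = \prod_(x <- rs) ('X - x%:P).
    by rewrite -map_poly_comp.
  by rewrite -(perm_mem (gal_root_map g PhiE' urs)) map_f.
have Xc0 : 'X - c%:P != 0 by rewrite monic_neq0 ?monicXsubC.
have [x1 x1r zx1] : exists2 x1, x1 \in rs & zf x1 = c.
  have : root (map_poly sp Phi) c by rewrite PhiS -mulrA rootM root_XsubC eqxx.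
  by rewrite spPhi -(big_map zf xpredT (fun z => 'X - z%:P)) root_prod_XsubC => /mapP[x1]; exists x1.
have PhiS1 : \prod_(x <- rem x1 rs) ('X - (zf x)%:P) = ('X - c%:P) * Psi.
  by apply: (mulfI Xc0); rewrite mulrA -PhiS spPhi [in RHS](big_rem x1 x1r) /= zx1.
have [x2 x2r zx2] : exists2 x2, x2 \in rem x1 rs & zf x2 = c.
  have : root (('X - c%:P) * Psi) c by rewrite rootM root_XsubC eqxx.
  by rewrite -PhiS1 -(big_map zf xpredT (fun z => 'X - z%:P)) root_prod_XsubC => /mapP[x2]; exists x2.
pose rest := rem x2 (rem x1 rs).
have PhiS2 : \prod_(x <- rest) ('X - (zf x)%:P) = Psi.
  by apply: (mulfI Xc0); rewrite -PhiS1 [in RHS](big_rem x2 x2r) /= zx2.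
have rs_perm : perm_eq rs [:: x1, x2 & rest].
  by rewrite (perm_trans (perm_to_rem x1r)) // perm_cons perm_to_rem.
have urest : uniq (map zf rest).
  by rewrite -separable_prod_XsubC big_map PhiS2.
have cnrest x : x \in rest -> zf x != c.
  move=> xr; apply: contraNneq Psi0 => zxc; rewrite -PhiS2.
  by rewrite -(big_map zf xpredT (fun z => 'X - z%:P)) -/(root _ _) root_prod_XsubC -zxc map_f.
have mem_rs x : (x \in rs) = [|| x == x1, x == x2 | x \in rest].
  by rewrite (perm_mem rs_perm) !inE.
have x12 : x1 != x2.
  by have := perm_uniq rs_perm; rewrite urs /= inE => /esym/andP[]; case: eqP.
have [g g1 gz] : exists2 g : G, g != 1%g & forall x, x \in rs -> zf (g x) = zf x.
  apply: contrapT => nog.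
  have [lf lfP] := choice sp_surj.
  (* With trivial inertia, each [h] other than 1 changes the residue of some root [xs h]. *)
  have [xs xsP] : exists xs : G -> L, forall h, h != 1%g ->
      xs h \in rs /\ zf (h (xs h)) != zf (xs h).
    suff /choice[xs xsP] : forall h : G, exists x, h != 1%g -> x \in rs /\ zf (h x) != zf x.
      by exists xs.
    move=> h; have [h1|h1] := eqVneq h 1%g; first by exists 0; rewrite ?h1 ?eqxx.
    apply: contrapT => /forallNP nox; apply: nog; exists h => // x xr.
    by apply/eqP/negPn/negP => zx; apply: (nox x).
  (* The residue of the factor of index [h] is that of [g (xs h)] minus that of [h (xs h)]: it is 0
     for [h = g], and never 0 for [g = 1]. *)
  pose beta (g : G) := \prod_(h : G | h != 1%g) (t (g (xs h)) - eta (lf (zf (h (xs h))))).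
  have betaE g : j (beta g) = g (j (beta 1%g)).
    rewrite !rmorph_prod; apply: eq_bigr => h h1; have [xr _] := xsP h h1.
    rewrite !rmorphB /= !tP ?gmem // gal_id -[j (eta _)]/((j \o eta) _) jeta.
    by rewrite /= rmorph_alg.
  have beta0 g : g != 1%g -> phi (beta g) = 0.
    move=> g1; rewrite rmorph_prod (bigD1 g) //= rmorphB.
    by rewrite -[phi (eta _)]/((phi \o eta) _) phieta lfP subrr mul0r.
  have beta1 : phi (beta 1%g) != 0.
    rewrite rmorph_prod; apply/prodf_neq0 => h h1; have [xr zx] := xsP h h1.
    rewrite rmorphB -[phi (eta _)]/((phi \o eta) _) phieta lfP gal_id.
    by rewrite subr_eq0 eq_sym.
  have dvd x : x \in rs -> zf x = c ->
      exists w b, phi w != 0 /\ w * (eta t0 - t x) = eta pi * b.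
    move=> xr zxc; pose xi (g : G) := eta t0 - t (g x).
    have [||w [b]] := @unramified_dvd B j phi eta j_inj jeta phieta j_int beta betaE beta0 beta1 xi.
    - move=> g; rewrite !rmorphB /= !tP ?gmem // gal_id -[j (eta _)]/((j \o eta) _) jeta.
      by rewrite /= rmorph_alg.
    - by rewrite /xi gal_id rmorphB -[phi (eta _)]/((phi \o eta) _) phieta -/(zf x) zxc subrr.
    by rewrite /xi gal_id => wb; exists w, b.
  have [w1 [b1 [w10 E1]]] := dvd _ x1r zx1.
  have x2rs : x2 \in rs by rewrite mem_rs eqxx orbT.
  have [w2 [b2 [w20 E2]]] := dvd _ x2rs zx2.
  pose v := \prod_(x <- rest) (eta t0 - t x).
  have E3 : eta pi * eta d = (eta t0 - t x1) * ((eta t0 - t x2) * v).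
    rewrite -rmorphM -Phit0 -horner_map /= etaPhi horner_prod (perm_big _ rs_perm) /=.
    rewrite !big_cons !hornerXsubC; do 2!congr (_ * _).
    by apply: eq_bigr => x _; rewrite hornerXsubC.
  (* One factor [pi] cancels; the left side has nonzero residue, while [pi] still divides the right
     side. *)
  have E4 : w1 * w2 * eta d = eta pi * (b1 * b2 * v).
    apply: j_inj; apply: (@mulfI _ (j (eta pi))).
      by rewrite -[j (eta _)]/((j \o eta) _) jeta -(rmorph0 (in_alg L \o i : {rmorphism A -> L}))
           (inj_eq (@iL_inj _ _ i i_inj L)).
    rewrite -!rmorphM; congr (j _).
    transitivity (w1 * (eta t0 - t x1) * (w2 * (eta t0 - t x2)) * v); last by rewrite E1 E2; ring.
    transitivity (w1 * w2 * (eta pi * eta d)); first by ring.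
    by rewrite E3; ring.
  have /eqP := congr1 phi E4; rewrite !rmorphM /= -![phi (eta _)]/((phi \o eta) _) !phieta.
  by rewrite sp_pi mul0r !mulf_eq0 (negPf w10) (negPf w20) (negPf d0).
have gfix x : x \in rest -> g x = x.
  move=> xr; have xrs : x \in rs by rewrite mem_rs xr !orbT.
  have := gmem g x xrs; rewrite mem_rs => /or3P[/eqP gx|/eqP gx|gxr].
  - by have := cnrest x xr; rewrite -gz // gx zx1 eqxx.
  - by have := cnrest x xr; rewrite -gz // gx zx2 eqxx.
  exact: (uniq_map_inj_in urest gxr xr (gz x xrs)).
have ginj : injective g by apply: fmorph_inj.
have x2rs : x2 \in rs by rewrite mem_rs eqxx orbT.
have pair x : zf x = c -> x \in rs -> g x = x1 \/ g x = x2.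
  move=> zxc xr; have := gmem g x xr; rewrite mem_rs => /or3P[/eqP|/eqP|gxr]; [by left|by right|].
  by have := cnrest _ gxr; rewrite gz // zxc eqxx.
have gx1 : g x1 = x2.
  have [gx1|//] := pair x1 zx1 x1r.
  case/negP: g1; apply/eqP/rs_gen => x; rewrite mem_rs => /or3P[/eqP ->|/eqP ->|/gfix] //.
  have [gx2|//] := pair x2 zx2 x2rs.
  by move: x12; rewrite -(inj_eq ginj) gx1 gx2 eqxx.
have gx2 : g x2 = x1.
  have [//|gx2] := pair x2 zx2 x2rs.
  by move: x12; rewrite -(inj_eq ginj) gx1 gx2 eqxx.
exists x1, x2, g; split=> //.
- by move=> x; rewrite mem_rs => /or3P[/eqP ->|/eqP ->|/gfix //]; rewrite eqxx.
(* An equation of [x1] over [A] specializes to an equation of its residue [sp t0]. *)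
move=> P rootP1.
have Pt : (map_poly eta P).[t x1] = 0.
  apply: j_inj; rewrite rmorph0 -horner_map /= -map_poly_comp (eq_map_poly jeta) tP //.
  exact/eqP.
have := congr1 phi Pt; rewrite rmorph0 -horner_map /= -map_poly_comp (eq_map_poly phieta).
by rewrite -/(zf x1) zx1 => P0; apply/eqP.
Qed.
End Inertia.

(** * Bivariate polynomials *)

Lemma tofrac_inj (R : idomainType) : injective (@FracField.tofrac R).
Proof. by move=> a b /eqP; rewrite tofrac_eq => /eqP. Qed.

Lemma clear_denominators (R : idomainType) (Q : {poly {fraction R}}) :
  exists e Q1, e != 0 /\ tofrac e *: Q = map_poly tofrac Q1.
Proof.
elim/poly_ind: Q => [|Q c [e [Q1 [e0 QE]]]].
  by exists 1, 0; rewrite oner_neq0 rmorph0 scaler0.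
have [n [d [d0 ->]]] := fraction_ex c.
exists (e * d), (d *: Q1 * 'X + (e * n)%:P); split; first by rewrite mulf_neq0.
rewrite [RHS]rmorphD [X in _ = X + _]rmorphM /= map_polyX map_polyC /= map_polyZ /= -QE scalerDr !rmorphM /=.
rewrite scalerA [tofrac d * _]mulrC -scalerAl; congr (_ + _).
rewrite -!polyCM -mul_polyC -polyCM; congr (_%:P).
by rewrite -mulrA; congr (_ * _); rewrite mulrCA divff ?mulr1 // tofrac_eq0.
Qed.

Lemma exists_nonroot (k : closedFieldType) (P : {poly k}) : P != 0 -> exists x, P.[x] != 0.
Proof. by move/closed_nonrootP. Qed.

Section Bivariate.
Variable k : closedFieldType.
Implicit Types F G H : {poly {poly k}}.
Local Notation ev u := (map_poly (horner_eval u)).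
Local Notation "F ^F" := (map_poly tofrac F) (at level 2).

(** As [k] is algebraically closed, this says that the coefficients of [F] in [k[t]] have no common
    factor. *)
Definition primitive2 F := forall u : k, ev u F != 0.

Lemma map_tofrac_inj : injective (fun F => F^F).
Proof. by apply: map_inj_poly; [apply: tofrac_inj | apply: rmorph0]. Qed.

Lemma size_map_tofrac F : size F^F = size F.
Proof. by rewrite size_map_inj_poly ?rmorph0 //; apply: tofrac_inj. Qed.

Lemma ev_eq0 (u : k) F : ev u F = 0 -> exists G, F = ('X - u%:P) *: G.
Proof.
move=> F0; have /choice[g gE] : forall j, exists g, F`_j = ('X - u%:P) * g.
  move=> j; have /factor_theorem[q ->] : root F`_j u.
    by have := congr1 (fun P : {poly k} => P`_j) F0; rewrite coef_map coef0 => /eqP.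
  by exists q; rewrite mulrC.
exists (\poly_(j < size F) g j); apply/polyP => j; rewrite coefZ coef_poly.
by case: ltnP => [_|h]; rewrite -?gE // mulr0 nth_default.
Qed.

Lemma evZ (u : k) (e : {poly k}) F : ev u (e *: F) = e.[u] *: ev u F.
Proof. by rewrite -[e *: F]mul_polyC rmorphM /= map_polyC /= mul_polyC. Qed.

Lemma size_poly1P (e : {poly k}) : e != 0 -> (size e <= 1)%N -> exists2 c, c != 0 & e = c%:P.
Proof.
move=> e0 /size1_polyC eE; exists e`_0 => //.
by apply: contraNneq e0 => c0; rewrite eE c0.
Qed.

Lemma poly_factor (e : {poly k}) : (1 < size e)%N ->
  exists u e1, e = ('X - u%:P) * e1 /\ size e = (size e1).+1.
Proof.
move=> e1; have /closed_rootP[u /factor_theorem[q qE]] : size e != 1%N by case: (size e) e1 => [|[]].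
exists u, q; split; first by rewrite mulrC.
rewrite qE size_Mmonic ?monicXsubC ?size_XsubC ?addn2 //.
by apply: contraTneq e1 => q0; rewrite qE q0 mul0r size_poly0.
Qed.

(** Gauss's lemma by removing the linear factors of [e] one by one: at a root [u] of [e] the product
    [G * H] vanishes, so ['X - u%:P] divides [G] or [H]. *)
Lemma gauss_clear (e : {poly k}) F G H : e != 0 -> e *: F = G * H ->
  exists G1 H1, [/\ F = G1 * H1, size G1 = size G & size H1 = size H].
Proof.
have [n] := ubnP (size e); elim: n e G H => // n IH e G H ltn e0 FE.
have [e1|e1] := leqP (size e) 1.
  have [c c0 eE] := size_poly1P e0 e1; exists (c^-1%:P *: G), H.
  have cu : c%:P * c^-1%:P = 1 :> {poly k} by rewrite -polyCM divff.
  rewrite size_scale ?polyC_eq0 ?invr_eq0 //; split=> //.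
  by rewrite -scalerAl -FE eE scalerA mulrC cu scale1r.
have [u [e' [eE sze]]] := poly_factor e1.
have e'0 : e' != 0 by apply: contraNneq e0 => h; rewrite eE h mulr0.
have Xu0 : 'X - u%:P != 0 :> {poly k} by rewrite monic_neq0 ?monicXsubC.
have lte' : (size e' < n)%N by rewrite -ltnS -sze.
have scaleI (P Q : {poly {poly k}}) : ('X - u%:P) *: P = ('X - u%:P) *: Q -> P = Q.
  move=> h; apply: (@mulfI _ ('X - u%:P)%:P); first by rewrite polyC_eq0.
  by rewrite !mul_polyC.
have : ev u G * ev u H = 0.
  by rewrite -rmorphM /= -FE evZ eE hornerM hornerXsubC subrr mul0r scale0r.
move/eqP; rewrite mulf_eq0 => /orP[] /eqP/ev_eq0[P PE].
  have [|G1 [H1 [F1 s1 s2]]] := IH e' P H lte' e'0.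
    by apply: scaleI; rewrite scalerA -eE FE PE scalerAl.
  by exists G1, H1; rewrite PE size_scale.
have [|G1 [H1 [F1 s1 s2]]] := IH e' G P lte' e'0.
  by apply: scaleI; rewrite scalerA -eE FE PE scalerAr.
by exists G1, H1; rewrite PE size_scale.
Qed.

Lemma unit_size F : F \is a GRing.unit -> size F = 1%N.
Proof. by rewrite poly_unitE => /andP[/eqP]. Qed.

(** A factorization over [k(t)], cleared of denominators, comes from one over [k[t]] with the same
    degrees in [x]. *)
Lemma irreducible_elt_tofrac F : (1 < size F)%N -> irreducible_elt F -> irreducible_poly F^F.
Proof.
move=> F1 [F0 [_ irr]]; split=> [|Q Q1 QF]; first by rewrite size_map_tofrac.
have [e [Q' [e0 Q'E]]] := clear_denominators Q.
have [e2 [R' [e20 R'E]]] := clear_denominators (F^F %/ Q).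
have FE : F^F = (F^F %/ Q) * Q by rewrite divpK.
have [||G1 [H1 [F1E s1 s2]]] := @gauss_clear (e2 * e) F R' Q'.
- by rewrite mulf_neq0.
- apply: map_tofrac_inj => /=; rewrite rmorphM /= -R'E -Q'E map_polyZ /= rmorphM /=.
  by rewrite {1}FE -scalerAl -scalerAr scalerA.
have szQ : size Q = size H1 by rewrite s2 -size_map_tofrac -Q'E size_scale // tofrac_eq0.
have [/unit_size|/unit_size h] := irr _ _ F1E; last by rewrite szQ h in Q1.
move=> G11; rewrite -(dvdp_size_eqp QF) size_map_tofrac szQ F1E.
have [c G1E] : exists c, G1 = c%:P by exists G1`_0; apply: size1_polyC; rewrite G11.
rewrite G1E mul_polyC size_scale //; apply: contraNneq F0 => c0.
by rewrite F1E G1E c0 mul0r.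
Qed.

Lemma irreducible_elt_primitive F : (1 < size F)%N -> irreducible_elt F -> primitive2 F.
Proof.
move=> F1 [F0 [_ irr]] u; apply/eqP => /ev_eq0[G FE].
have [||/unit_size G1] := irr ('X - u%:P)%:P G; first by rewrite mul_polyC.
  by rewrite poly_unitE coefC /= poly_unitE size_XsubC andbF.
have Xu0 : 'X - u%:P != 0 :> {poly k} by rewrite monic_neq0 ?monicXsubC.
by move: F1; rewrite FE size_scale // G1.
Qed.

(** In any factorization one factor has degree 0 in [x]. If it were not a constant of [k], it would
    vanish at some [v], against primitivity. *)
Lemma primitive_irreducible_elt H : primitive2 H -> irreducible_poly H^F -> irreducible_elt H.
Proof.
move=> Hp [szH irr]; rewrite size_map_tofrac in szH.
have H0 : H != 0 by apply: contraTneq szH => ->; rewrite size_poly0.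
split=> //; split; first by apply: contraL szH => /unit_size ->.
have wlog1 (U V : {poly {poly k}}) : H = U * V -> size U = 1%N -> U \is a GRing.unit.
  move=> HE U1; have [u UE] : exists u, U = u%:P by exists U`_0; apply: size1_polyC; rewrite U1.
  rewrite UE poly_unitE size_polyC coefC /=.
  have u0 : u != 0 by apply: contraNneq H0 => h; rewrite HE UE h mul0r.
  rewrite u0 /=; have [u1|u1] := leqP (size u) 1.
    have [c c0 ->] := size_poly1P u0 u1.
    by rewrite poly_unitE size_polyC c0 coefC unitfE.
  have [v [u' [uE _]]] := poly_factor u1.
  have := Hp v; rewrite HE UE uE mul_polyC evZ hornerM hornerXsubC subrr mul0r scale0r eqxx //.
move=> U V HE.
have [U1|U1] := eqVneq (size U) 1%N; first by left; apply: (wlog1 U V).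
right; apply: (wlog1 V U); first by rewrite mulrC.
have := irr U^F; rewrite size_map_tofrac => /(_ U1).
rewrite HE rmorphM /= dvdp_mulr // => /(_ isT)/eqp_size.
have U0 : U != 0 by apply: contraNneq H0 => h; rewrite HE h mul0r.
have V0 : V != 0 by apply: contraNneq H0 => h; rewrite HE h mulr0.
rewrite -rmorphM /= !size_map_tofrac size_mul //.
have : (0 < size V)%N by rewrite size_poly_gt0.
case: (size V) => // n _; rewrite addnS /= => /eqP.
by rewrite -{1}[size U]addn0 eqn_add2l => /eqP <-.
Qed.

(** A root of [d] is a root of [n] because [F] does not vanish there, and conversely; cancelling
    common linear factors leaves constants. *)
Lemma primitive_scale (n d : {poly k}) F G : primitive2 F -> primitive2 G ->
  n != 0 -> d != 0 -> n *: F = d *: G -> exists2 c : k, c != 0 & F = c%:P *: G.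
Proof.
move=> Fp Gp; have [m] := ubnP (size d); elim: m n d => // m IH n d ltm n0 d0 FG.
have [d1|d1] := leqP (size d) 1.
  have [c c0 dE] := size_poly1P d0 d1.
  have [n1|n1] := leqP (size n) 1.
    have [b b0 nE] := size_poly1P n0 n1; exists (b^-1 * c); first by rewrite mulf_neq0 ?invr_eq0.
    by rewrite polyCM -scalerA -dE -FG nE scalerA -polyCM mulVf // scale1r.
  have [u [n' [nE _]]] := poly_factor n1.
  have := congr1 (fun P => ev u P) FG; rewrite /= !evZ nE dE hornerM hornerXsubC.
  rewrite subrr mul0r scale0r hornerC => /esym/eqP; rewrite scaler_eq0 (negPf c0).
  by rewrite (negPf (Gp u)).
have [u [d' [dE szd]]] := poly_factor d1.
have := congr1 (fun P => ev u P) FG; rewrite /= !evZ dE hornerM hornerXsubC.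
rewrite subrr mul0r scale0r => /eqP; rewrite scaler_eq0 (negPf (Fp u)) orbF.
move=> /factor_theorem[n' nE]; apply: (IH n' d').
- by rewrite -ltnS -szd.
- by apply: contraNneq n0 => h; rewrite nE h mul0r.
- by apply: contraNneq d0 => h; rewrite dE h mulr0.
apply: (@mulfI _ ('X - u%:P)%:P); first by rewrite polyC_eq0 monic_neq0 ?monicXsubC.
by rewrite !mul_polyC !scalerA -dE mulrC -nE.
Qed.

Lemma eqp_associated F G : primitive2 F -> primitive2 G -> F^F %= G^F -> associated F G.
Proof.
move=> Fp Gp; rewrite eqp_sym => /eqpf_eq[c c0 FE].
have [n [d [d0 cE]]] := fraction_ex c.
have n0 : n != 0 by apply: contraNneq c0 => h; rewrite cE h rmorph0 mul0r.
have {}FE : n *: F = d *: G.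
  have d0' : tofrac d != 0 by rewrite tofrac_eq0.
  apply: map_tofrac_inj => /=; rewrite !map_polyZ /= FE cE scalerA.
  by congr (_ *: _); rewrite mulrC divfK.
have [b b0 ->] := primitive_scale Fp Gp n0 d0 FE.
exists b%:P%:P; last by rewrite mul_polyC.
by rewrite !(rmorph_unit polyC) // unitfE.
Qed.

Lemma associated_eqp F G : associated F G -> F^F %= G^F.
Proof.
case=> u /unit_size u1 ->.
have [c uE] : exists c, u = c%:P by exists u`_0; apply: size1_polyC; rewrite u1.
have c0 : c != 0 by apply: contraPneq u1 => h; rewrite uE h size_poly0.
by rewrite uE mul_polyC map_polyZ /= eqp_scale // tofrac_eq0.
Qed.
End Bivariate.

(** * Affine substitutions and separability over a field *)

Section FieldPoly.
Variable E : fieldType.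
Implicit Types P Q : {poly E}.

Lemma irreducible_eqp P Q : P %= Q -> irreducible_poly P -> irreducible_poly Q.
Proof.
move=> PQ [szP irr]; split; first by rewrite -(eqp_size PQ).
by move=> R R1; rewrite -(eqp_dvdr R PQ) => /(irr _ R1) h; apply: eqp_trans PQ.
Qed.

Definition affine (b a : E) : {poly E} := b *: 'X + a%:P.

Lemma size_affine b a : b != 0 -> size (affine b a) = 2.
Proof.
by move=> b0; rewrite /affine size_polyDl ?size_scale ?size_polyX // ltnS size_polyC_leq1.
Qed.

Lemma affineK b a P : b != 0 -> (P \Po affine b a) \Po affine b^-1 (- (a / b)) = P.
Proof.
move=> b0; rewrite -comp_polyA; suff -> : affine b a \Po affine b^-1 (- (a / b)) = 'X by rewrite comp_polyXr.
rewrite /affine comp_polyD comp_polyZ comp_polyX comp_polyC scalerDr scalerA divff // scale1r.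
by rewrite -mul_polyC -polyCM mulrN mulrCA divff // mulr1 polyCN addrNK.
Qed.

Lemma irreducible_affine b a P : b != 0 -> irreducible_poly P -> irreducible_poly (P \Po affine b a).
Proof.
move=> b0 [szP irr]; have sz := size_affine a b0.
split; first by rewrite size_comp_poly2.
move=> Q Q1 QP; rewrite -(dvdp_size_eqp QP) size_comp_poly2 //.
have sz' : size (affine b^-1 (- (a / b))) = 2 by rewrite size_affine ?invr_eq0.
rewrite -(size_comp_poly2 Q sz') -/(size _ == _); apply/eqP/eqp_size/irr.
  by rewrite size_comp_poly2.
by rewrite -(affineK a P b0) dvdp_comp_poly.
Qed.

Lemma eqp_affine b a P Q : b != 0 -> P \Po affine b a %= Q \Po affine b a -> P %= Q.
Proof.
move=> b0; rewrite -{2}(affineK a P b0) -{2}(affineK a Q b0) => /andP[h1 h2].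
by apply/andP; split; apply: dvdp_comp_poly.
Qed.

Lemma eqp_scaled b a P Q : b != 0 -> a != 0 -> P %= Q -> b *: P %= a *: Q.
Proof.
move=> b0 a0 PQ; rewrite (eqp_ltrans (eqp_scale _ b0)).
by rewrite (eqp_rtrans (eqp_scale _ a0)).
Qed.

(** The degree is positive and less than [p], so the derivative is nonzero; having smaller degree,
    it is coprime to the irreducible [Q]. *)
Lemma separable_irreducible p Q : p \in [pchar E] -> irreducible_poly Q -> (size Q <= p)%N ->
  separable_poly Q.
Proof.
move=> pE irrQ szp; have [szQ _] := irrQ; rewrite unlock irreducible_poly_coprime //.
have Q'0 : Q^`() != 0.
  apply/eqP => Q'0; have := congr1 (fun P : {poly E} => P`_(size Q).-2) Q'0.
  rewrite coef_deriv coef0 -mulr_natr => /eqP; rewrite mulf_eq0.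
  have -> : (size Q).-2.+1 = (size Q).-1 by case: (size Q) szQ => [|[]].
  rewrite -/(lead_coef Q) lead_coef_eq0 (negPf (irredp_neq0 irrQ)) /=.
  rewrite -(dvdn_pcharf pE) gtnNdvd //; first by case: (size Q) szQ => [|[]].
  by case: (size Q) szQ szp.
by apply: contraL (lt_size_deriv (irredp_neq0 irrQ)) => /(dvdp_leq Q'0); rewrite -leqNgt.
Qed.

Lemma bezout_scale (a b : E) U V P P' : U * P + V * P' = 1 ->
  (b *: (a *: U)) * P + (a *: (b *: V)) * P' = (a * b)%:P.
Proof.
by move=> UV; rewrite -!scalerAl !scalerA [b * a]mulrC -scalerDr UV alg_polyC.
Qed.

Lemma separable_prod_irreducible p (I : finType) (Q : I -> {poly E}) :
    p \in [pchar E] -> (forall i, irreducible_poly (Q i)) -> (forall i, (size (Q i) <= p)%N) ->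
    (forall i j, i != j -> ~~ (Q i %= Q j)) ->
  separable_poly (\prod_i Q i).
Proof.
move=> pE irrQ szp neq; have := index_enum_uniq I; elim: (index_enum I) => [_|i s IH /=].
  by rewrite big_nil unlock coprime1p.
case/andP=> is_ us; rewrite big_cons separable_mul (separable_irreducible pE) //= IH //=.
rewrite big_seq; apply: (big_ind (fun P => coprimep (Q i) P)).
- exact: coprimep1.
- by move=> P P' h h'; rewrite coprimepMr h.
move=> j js; rewrite irreducible_poly_coprime //; apply: contraNN (neq i j _) => [QQ|].
  by apply: (irrQ j).2 => //; case: (irrQ i) => + _; case: (size (Q i)) => [|[]].
by apply: contraNneq is_ => ->.
Qed.
End FieldPoly.

(** * Pencils as affine changes of variable, and separability of almost all fibers *)

Section Pencil.
Variable k : closedFieldType.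
Implicit Types F G H : {poly {poly k}}.
Local Notation ev u := (map_poly (horner_eval u)).
Local Notation "F ^F" := (map_poly tofrac F) (at level 2).

(** A Bezout identity for [F] and its derivative over [k(t)], cleared of denominators, survives
    evaluation at every [u] where the cleared denominator [e] is nonzero. *)
Lemma generic_separable F : separable_poly F^F ->
  exists2 e : {poly k}, e != 0 & forall u, e.[u] != 0 -> separable_poly (ev u F).
Proof.
rewrite unlock => /Bezout_eq1_coprimepP[[U V] /= UV].
have [e1 [U1 [e10 UE]]] := clear_denominators U.
have [e2 [V1 [e20 VE]]] := clear_denominators V.
have E : (e1 * e2)%:P = (e2 *: U1) * F + (e1 *: V1) * F^`().
  apply: map_tofrac_inj; rewrite map_polyC [RHS]rmorphD ![in RHS]rmorphM /= !map_polyZ /= -UE -VE.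
  rewrite -deriv_map [tofrac (e1 * e2)]rmorphM /=.
  have B := bezout_scale (tofrac e1) (tofrac e2) UV.
  rewrite B.
  exact: erefl.
exists (e1 * e2); first by rewrite mulf_neq0.
move=> u eu; have := congr1 (fun P => ev u P) E.
rewrite /= map_polyC rmorphD !rmorphM /= -deriv_map => Eu.
apply/Bezout_eq1_coprimepP; pose c := ((e1 * e2).[u])^-1.
exists (c *: ev u (e2 *: U1), c *: ev u (e1 *: V1)) => /=.
by rewrite -!scalerAl -scalerDr -Eu /horner_eval -mul_polyC -polyCM mulVf.
Qed.

Lemma swapXY_unit F : F \is a GRing.unit -> swapXY F \is a GRing.unit.
Proof.
move=> /unitrP[G [GF FG]]; apply/unitrP; exists (swapXY G).
by rewrite -!rmorphM GF FG rmorph1.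
Qed.

Lemma irreducible_elt_swap F : irreducible_elt F -> irreducible_elt (swapXY F).
Proof.
have swU G : (swapXY G \is a GRing.unit) = (G \is a GRing.unit).
  by apply/idP/idP => /swapXY_unit; rewrite ?swapXYK.
move=> [F0 [Fu irr]]; split; first by rewrite swapXY_eq0.
split; first by rewrite swU.
move=> b c Fbc; have := irr (swapXY b) (swapXY c); rewrite !swU; apply.
by rewrite -rmorphM /= -Fbc swapXYK.
Qed.

Lemma associated_swap F G : associated (swapXY F) (swapXY G) -> associated F G.
Proof.
case=> u uU FG; exists (swapXY u); first exact: swapXY_unit.
by rewrite -[F]swapXYK FG rmorphM /= swapXYK.
Qed.

(** The outer variable of the result is the parameter [s] of the family [l + s q]; applying [swapXY]
    gives a polynomial in [t] over [k[s]]. *)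
Definition pencil (q l : {poly k}) F := F \Po (q *: 'X + l%:P).

Lemma pencil_tofrac q l F : (pencil q l F)^F = F^F \Po affine (tofrac q) (tofrac l).
Proof. by rewrite /pencil map_comp_poly rmorphD /= map_polyZ /= map_polyX map_polyC. Qed.

(** Over [k(t)] the substitution is an invertible affine one and [r] is a unit; primitivity of [H]
    brings irreducibility back to polynomials over [k[t]]. *)
Lemma pencil_irreducible q l r F H : q != 0 -> r != 0 -> irreducible_elt F -> (1 < size F)%N ->
  pencil q l F = r *: H -> primitive2 H -> irreducible_elt H.
Proof.
move=> q0 r0 irrF F1 FE Hp; apply: primitive_irreducible_elt => //.
apply: (irreducible_eqp (P := (pencil q l F)^F)).
  by rewrite FE map_polyZ /= eqp_scale // tofrac_eq0.
by rewrite pencil_tofrac; apply: irreducible_affine; rewrite ?tofrac_eq0 //; apply: irreducible_elt_tofrac.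
Qed.

Lemma pencil_associated q l r r' F F' H H' : q != 0 -> r != 0 -> r' != 0 ->
    primitive2 F -> primitive2 F' ->
    pencil q l F = r *: H -> pencil q l F' = r' *: H' ->
  associated H H' -> associated F F'.
Proof.
move=> q0 r0 r'0 Fp F'p FE F'E /associated_eqp HH; apply: eqp_associated Fp F'p _.
have q0' : tofrac q != 0 by rewrite tofrac_eq0.
apply: (eqp_affine (a := tofrac l) q0'); rewrite -!pencil_tofrac FE F'E !map_polyZ /=.
by apply: eqp_scaled; rewrite ?tofrac_eq0.
Qed.
End Pencil.

(** * Substitution and degree in t *)

Section Degree.
Lemma coefM_top (R : nzRingType) (P Q : {poly R}) a b :
  (size P <= a.+1)%N -> (size Q <= b.+1)%N -> (P * Q)`_(a + b) = P`_a * Q`_b.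
Proof.
move=> hP hQ; have aab : (a < (a + b).+1)%N by rewrite ltnS leq_addr.
rewrite coefM (bigD1 (Ordinal aab)) //= addKn big1 ?addr0 // => j ja.
have [aj|ja'] := ltnP a j; first by rewrite [P`_j]nth_default ?mul0r // (leq_trans hP).
rewrite [Q`_ _]nth_default ?mulr0 // (leq_trans hQ) // ltn_subRL addnC -ltn_subRL.
by rewrite addnK ltn_neqAle ja' andbT.
Qed.

Lemma size_top (R : nzRingType) (P Q : {poly R}) a b :
  (size P <= a.+1)%N -> (size Q <= b.+1)%N -> (size (P * Q)%R <= (a + b).+1)%N.
Proof.
move=> hP hQ; rewrite (leq_trans (size_polyMleq _ _)) // -ltnS.
apply: (@leq_ltn_trans (size P + size Q).-1) => //.
by rewrite -addSn; case: (size P + size Q)%N (leq_add hP hQ) => // s; rewrite addnS.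
Qed.

Lemma exp_top (R : nzRingType) (f : {poly R}) n j : (size f <= n.+1)%N ->
  (size (f ^+ j)%R <= (n * j).+1)%N /\ (f ^+ j)`_(n * j) = f`_n ^+ j.
Proof.
move=> hf; elim: j => [|j [IH1 IH2]].
  by rewrite muln0 !expr0 size_poly1 coef1.
by rewrite mulnS !exprS size_top // coefM_top // IH2.
Qed.

Variables (k : fieldType) (n : nat).
Implicit Types F : {poly {poly k}}.

(** The weighted degree of [F] with weight 1 for [t] and weight [n] for [x], which is the degree of
    [F(t, f)] for generic [f]. *)
Definition tdeg F := (\max_(j < size F | (F`_j)%R != 0%R) ((size (F`_j)%R).-1 + n * j))%N.

(* leading coefficient in t of F(t, f), as a polynomial in the coefficient of
   t^n of f *)
Definition tlead F : {poly k} :=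
  \poly_(j < size F) (if (n * j <= tdeg F)%N then F`_j`_(tdeg F - n * j) else 0).

Lemma tdeg_ge F j : F`_j != 0 -> ((size (F`_j)%R).-1 + n * j <= tdeg F)%N.
Proof.
move=> Fj; have jF : (j < size F)%N by rewrite ltnNge; apply: contra Fj => h; rewrite nth_default.
exact: (@leq_bigmax_cond _ _ (fun j : 'I_(size F) => (size (F`_j)%R).-1 + n * j)%N (Ordinal jF)).
Qed.

Lemma tdeg_size F : (1 < size F)%N -> (n * (size F).-1 <= tdeg F)%N.
Proof.
move=> F1; apply: leq_trans (tdeg_ge (j := (size F).-1) _); first exact: leq_addl.
by rewrite -/(lead_coef F) lead_coef_eq0 -size_poly_gt0 ltnW.
Qed.

Lemma tlead_neq0 F : F != 0 -> tlead F != 0.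
Proof.
move=> F0; have sF : ((size F).-1 < size F)%N by rewrite prednK ?size_poly_gt0.
have [|j Fj jmax] := @eq_bigmax_cond _ (fun j : 'I_(size F) => F`_j != 0)
    (fun j : 'I_(size F) => ((size (F`_j)%R).-1 + n * j)%N).
  by apply/card_gt0P; exists (Ordinal sF); rewrite unfold_in /= -/(lead_coef F) lead_coef_eq0.
apply: contraNneq Fj => /(congr1 (fun P : {poly k} => P`_j)).
rewrite coef0 coef_poly ltn_ord /tdeg jmax leq_addl addnK => h.
by rewrite -lead_coef_eq0 lead_coefE h.
Qed.

Definition subst (R : comNzRingType) (e : {rmorphism k -> R}) F (f : {poly R}) : {poly R} :=
  (map_poly (map_poly e) F).[f].

(** The degree of [F(t, f)] is therefore exactly [tdeg F] as soon as [tlead F] does not vanish at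
    the coefficient of [t^n] in [f]. *)
Lemma subst_top (R : comNzRingType) (e : {rmorphism k -> R}) F (f : {poly R}) :
    (size f <= n.+1)%N ->
  (size (subst e F f) <= (tdeg F).+1)%N /\
  (subst e F f)`_(tdeg F) = (map_poly e (tlead F)).[f`_n].
Proof.
move=> hf; have substE : subst e F f = \sum_(j < size F) map_poly e F`_j * f ^+ j.
  rewrite /subst (horner_coef_wide _ (n := size F)); last exact: size_poly.
  by apply: eq_bigr => j _; rewrite coef_map.
have term (j : 'I_(size F)) : (size (map_poly e F`_j * f ^+ j)%R <= (tdeg F).+1)%N /\
   (map_poly e F`_j * f ^+ j)`_(tdeg F) = (map_poly e (tlead F))`_j * f`_n ^+ j.
  have -> : (map_poly e (tlead F))`_j =
      e (if (n * j <= tdeg F)%N then F`_j`_(tdeg F - n * j) else 0).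
    by rewrite coef_map /tlead coef_poly ltn_ord.
  have [->|Fj] := eqVneq F`_j 0.
    by rewrite rmorph0 mul0r !coef0 size_poly0 if_same rmorph0 mul0r.
  have jN := tdeg_ge Fj; have nj : (n * j <= tdeg F)%N by apply: leq_trans jN; apply: leq_addl.
  have sF : (size (map_poly e F`_j)%R <= (tdeg F - n * j).+1)%N.
    by rewrite (leq_trans (size_poly _ _)) // (leq_trans (leqSpred _)) // ltnS -(leq_add2r (n * j)) subnK.
  have [sf cf] := exp_top j hf.
  rewrite nj -{1 2}(subnK nj) size_top // coefM_top // cf.
  by rewrite coef_map.
rewrite substE; split.
  apply: (big_ind (fun P : {poly R} => size P <= (tdeg F).+1)%N).
  - by rewrite size_poly0.
  - by move=> P Q hP hQ; rewrite (leq_trans (size_polyD _ _)) // geq_max hP.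
  by move=> j _; case: (term j).
rewrite coef_sum (horner_coef_wide _ (n := size F)).
  by apply: eq_bigr => j _; case: (term j).
by rewrite (leq_trans (size_poly _ _)) // size_poly.
Qed.

Lemma map_subst (R S : comNzRingType) (e : {rmorphism k -> R}) (h : {rmorphism R -> S})
  (e' : {rmorphism k -> S}) F f : h \o e =1 e' ->
  map_poly h (subst e F f) = subst e' F (map_poly h f).
Proof.
move=> he; rewrite /subst -horner_map /= -map_poly_comp; congr (_.[_]).
by apply: eq_map_poly => P /=; rewrite -map_poly_comp; apply: eq_map_poly.
Qed.

Lemma subst_prod (R : comNzRingType) (e : {rmorphism k -> R}) (I : finType)
   (Fs : I -> {poly {poly k}}) f :
  subst e (\prod_i Fs i) f = \prod_i subst e (Fs i) f.
Proof. by rewrite /subst rmorph_prod horner_prod. Qed.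
End Degree.

(** * Pencils of polynomials *)

Section Tangent.
Variable k : closedFieldType.
Implicit Types F G H : {poly {poly k}}.
Implicit Types q l r : {poly k}.
Local Notation ev u := (map_poly (horner_eval u)).

Lemma ev_horner (u : k) F l : (F.[l]).[u] = (ev u F).[l.[u]].
Proof. by rewrite -[l.[u]]/(horner_eval u l) horner_map. Qed.

Lemma pencil_horner q l F r : (pencil q l F).[r] = F.[l + q * r].
Proof.
by rewrite /pencil horner_comp hornerD hornerZ hornerX hornerC addrC.
Qed.

Lemma pencil_taylor q l F : exists W, pencil q l F =
  (F.[l])%:P + (q * F^`().[l])%:P * 'X + (q * q)%:P * ('X * 'X * W).
Proof.
rewrite /pencil -mul_polyC; elim/poly_ind: F => [|F c [W IH]].
  by exists 0; rewrite comp_poly0 deriv0 !horner0 !mulr0 mul0r !addr0.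
exists (F^`().[l]%:P + W * (q%:P * 'X + l%:P)).
rewrite comp_polyD comp_polyM comp_polyX comp_polyC IH derivD derivC derivM derivX addr0 mulr1.
rewrite !(hornerD, hornerM, hornerX, hornerC, polyCD, polyCM).
ring.
Qed.

(** By Taylor expansion, [q] divides the whole pencil once it divides [F(t, l)]. At a root of [q]
    the quotient has degree at most 1 in [s], with the [x]-derivative as slope. *)
Lemma pencil_quot q l F r t0 : F.[l] = q * r -> q.[t0] = 0 ->
  exists2 H, pencil q l F = q *: H &
    ev t0 H = (r.[t0])%:P + (F^`().[l].[t0])%:P * 'X.
Proof.
move=> Fl qt0; have [W PE] := pencil_taylor q l F.
exists (r%:P + F^`().[l]%:P * 'X + q%:P * ('X * 'X * W)).
  by rewrite PE Fl -mul_polyC !polyCM; ring.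
rewrite !rmorphD !rmorphM /= !map_polyC /= map_polyX /horner_eval qt0.
by rewrite polyC0 mul0r addr0.
Qed.

Lemma ev_pencil_neq0 q l F r H u : primitive2 F -> pencil q l F = r *: H ->
  q.[u] != 0 -> ev u H != 0.
Proof.
move=> Fp FE qu; apply: contraNneq (Fp u) => Hu.
have := congr1 (fun P => ev u P) FE; rewrite /= evZ Hu scaler0 /pencil map_comp_poly.
rewrite rmorphD /= map_polyZ /= map_polyX map_polyC /= => h.
by rewrite -(affineK (l.[u]) (ev u F) qu) [X in X \Po _]h comp_poly0.
Qed.

Lemma swap_pencil q l F :
  swapXY (pencil q l F) = subst polyC F (map_poly polyC l + 'X%:P * map_poly polyC q).
Proof.
rewrite /pencil /subst /comp_poly -horner_map /= -map_poly_comp.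
congr (_.[_]); first by apply: eq_map_poly => P /=; rewrite swapXY_polyC.
by rewrite rmorphD /= -mul_polyC rmorphM /= !swapXY_polyC swapXY_X addrC mulrC.
Qed.

Lemma ev_swap_pencil q l F c : ev c (swapXY (pencil q l F)) = F.[l + c%:P * q].
Proof.
have evC (P : {poly k}) : ev c (map_poly polyC P) = P.
  by rewrite -map_poly_comp map_poly_id // => x _ /=; rewrite /horner_eval hornerC.
rewrite swap_pencil /subst -horner_map /= -map_poly_comp.
rewrite rmorphD rmorphM /= !evC map_polyC /= /horner_eval hornerX.
by congr (_.[_]); rewrite map_poly_id // => P _ /=; rewrite evC.
Qed.

Lemma ev_swapC (u c : k) H : (ev u H).[c] = (ev c (swapXY H)).[u].
Proof.
by rewrite -[ev c _]horner_swapXY swapXYK ev_horner hornerC.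
Qed.

Section Family.
Variables (p : nat) (m n : nat) (Fs : 'I_m -> {poly {poly k}}).
Hypotheses (hchar : p \in [pchar k]) (hdeg : forall j, (1 < size (Fs j))%N)
  (hirr : forall j, irreducible_elt (Fs j))
  (hnassoc : forall i j, i != j -> ~ associated (Fs i) (Fs j))
  (hn3 : (3 <= n)%N) (hp : forall j, (tdeg n (Fs j) < p)%N).

Let Fprim j : primitive2 (Fs j).
Proof. exact: irreducible_elt_primitive. Qed.

Lemma pchar_fraction : p \in [pchar {fraction {poly k}}].
Proof.
by rewrite (rmorph_pchar (tofrac \o polyC : {rmorphism k -> {fraction {poly k}}})).
Qed.

Lemma family_irreducible q l j : (forall u, q.[u] != 0) ->
  irreducible_elt (pencil q l (Fs j)).
Proof.
move=> qu; have q0 : q != 0 by apply: contraNneq (qu 0) => ->; rewrite horner0.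
apply: (@pencil_irreducible _ q l 1 (Fs j)); rewrite ?oner_neq0 ?scale1r // => u.
by apply: (@ev_pencil_neq0 q l (Fs j) 1); rewrite ?scale1r.
Qed.

(** For almost all [t0] the fiber of [C] is reduced, so a point [(t0, x0)] of the curve of [Fs i] is
    simple on [C] with nonvertical tangent. The polynomial [l] is this tangent plus [eps] times the
    [n]-th power of [t - t0]. *)
Lemma tangent_exists i : exists t0 l r, [/\ (t0 != 0 :> k) /\ (size l <= n.+1)%N,
  forall j, (tlead n (Fs j)).[l`_n] != 0,
  (Fs i).[l] = ('X - t0%:P) ^+ 2 * r,
  (Fs i)^`().[l].[t0] != 0 & forall j, j != i -> (Fs j).[l].[t0] != 0].
Proof.
have sepF : separable_poly (map_poly tofrac (\prod_j Fs j)).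
  rewrite rmorph_prod; apply: (separable_prod_irreducible pchar_fraction) => [j|j|j1 j2 j12].
  - exact: irreducible_elt_tofrac.
  - rewrite size_map_tofrac; have := tdeg_size n (hdeg j); have := hp j.
    case: (size (Fs j)) (hdeg j) => // s _ /= h1 h2.
    apply: leq_ltn_trans h1; apply: leq_trans h2.
    by apply: leq_pmull; apply: leq_trans hn3.
  - by apply/negP => /(eqp_associated (Fprim j1) (Fprim j2)); apply: hnassoc.
have [e e0 esep] := generic_separable sepF.
(* The factor ['X] keeps [t0] away from 0, [e] makes the fiber separable, and the leading
   coefficient preserves the degree of [Fs i], so that a root [x0] exists. *)
have [t0] : exists t0, ('X * e * lead_coef (Fs i)).[t0] != 0.
  apply: exists_nonroot; rewrite !mulf_neq0 ?polyX_eq0 // lead_coef_eq0.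
  by have [] := hirr i.
rewrite !hornerM hornerX !mulf_eq0 !negb_or => /andP[/andP[t00 et0] lct0].
have [x0 x0P] : exists x0, root (ev t0 (Fs i)) x0.
  apply/closed_rootP; rewrite size_poly_eq; first by rewrite gtn_eqF.
  exact: lct0.
have := esep t0 et0; rewrite rmorph_prod (bigD1 i) //= separable_mul => /and3P[sep1 _ cop].
have Fx0 : ((ev t0 (Fs i))^`()).[x0] != 0.
  by move: sep1; rewrite unlock => /coprimep_root; apply.
have Fjx0 j : j != i -> (ev t0 (Fs j)).[x0] != 0.
  move=> ji; have := coprimep_root cop x0P; rewrite horner_prod => /prodf_neq0; exact.
have [eps] : exists eps, (\prod_j tlead n (Fs j)).[eps] != 0.
  apply: exists_nonroot; apply/prodf_neq0 => j _; apply: tlead_neq0.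
  by have [] := hirr j.
rewrite horner_prod => /prodf_neq0 epsP.
pose X0 : {poly k} := 'X - t0%:P.
have [A0 A0E] : exists A0, (Fs i).[x0%:P] = X0 * A0.
  have /factor_theorem[A0 ->] : root (Fs i).[x0%:P] t0.
    by rewrite /root ev_horner hornerC.
  by exists A0; rewrite mulrC.
(* The slope of the tangent: minus the [t]-derivative, which is [A0.[t0]], over the
   [x]-derivative. *)
pose mu := - (A0.[t0] / ((ev t0 (Fs i))^`()).[x0]).
pose w : {poly k} := mu%:P + eps%:P * X0 ^+ n.-1.
pose l := x0%:P + X0 * w.
have n1 : n.-1.+1 = n by rewrite prednK // (leq_trans _ hn3).
have X0t0 : X0.[t0] = 0 by rewrite hornerXsubC subrr.
have wt0 : w.[t0] = mu.
  rewrite hornerD hornerM !hornerC horner_exp X0t0 expr0n.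
  by case: n hn3 => [|[]] // ? _; rewrite mulr0 addr0.
have lt0 : l.[t0] = x0 by rewrite hornerD hornerM X0t0 mul0r addr0 hornerC.
have lE : l = x0%:P + mu%:P * X0 + eps%:P * X0 ^+ n.
  have -> : X0 ^+ n = X0 * X0 ^+ n.-1 by rewrite -exprS n1.
  by rewrite /l /w; move: (X0 ^+ n.-1) => Y; ring.
have szX0n : size (X0 ^+ n) = n.+1 by rewrite size_exp_XsubC.
have sz1 : (size (x0%:P + mu%:P * X0)%R <= 2)%N.
  rewrite (leq_trans (size_polyD _ _)) // geq_max (leq_trans (size_polyC_leq1 x0)) //=.
  by rewrite mul_polyC (leq_trans (size_scale_leq _ _)) // size_XsubC.
have sz1n := leq_trans sz1 (ltnW hn3).
exists t0, l.
have [W WE] := pencil_taylor X0 x0%:P (Fs i).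
have Fl : (Fs i).[l] = X0 * (A0 + w * (Fs i)^`().[x0%:P] + X0 * (w * w * W.[w])).
  rewrite /l -pencil_horner WE A0E !hornerD !hornerM !hornerC hornerX; ring.
(* The choice of [mu] makes this factor vanish at [t0], which yields the second factor
   ['X - t0%:P]. *)
have /factor_theorem[r rE] : root (A0 + w * (Fs i)^`().[x0%:P] + X0 * (w * w * W.[w])) t0.
  rewrite /root !hornerD !hornerM X0t0 mul0r addr0 wt0 ev_horner hornerC -deriv_map.
  by rewrite /mu mulNr divfK // subrr.
exists r; split.
- split=> //; rewrite lE (leq_trans (size_polyD _ _)) // geq_max (leqW sz1n) /=.
  by rewrite mul_polyC (leq_trans (size_scale_leq _ _)) // szX0n.
- move=> j; have -> : l`_n = eps; last exact: epsP.
  rewrite lE coefD nth_default ?add0r //.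
  have := monicP (monic_exp n (monicXsubC t0)); rewrite lead_coefE szX0n /= => h.
  by rewrite mul_polyC coefZ h mulr1.
- by rewrite Fl rE expr2 -mulrA [r * _]mulrC.
- by rewrite ev_horner lt0 -deriv_map.
by move=> j ji; rewrite ev_horner lt0; apply: Fjx0.
Qed.

(** As [q] has degree less than [n], the coefficient of [t^n] in [l + s q] is that of [l], a
    constant at which [tlead n F] does not vanish. *)
Lemma size_swap_pencil q l F : (size l <= n.+1)%N -> (size q <= n)%N ->
  (tlead n F).[l`_n] != 0 -> size (swapXY (pencil q l F)) = (tdeg n F).+1.
Proof.
move=> szl szq ld; rewrite swap_pencil.
set f := map_poly polyC l + _.
have szf : (size f <= n.+1)%N.
  rewrite (leq_trans (size_polyD _ _)) // geq_max size_map_polyC szl mul_polyC.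
  by rewrite (leq_trans (size_scale_leq _ _)) // size_map_polyC leqW.
have fn : f`_n = (l`_n)%:P.
  by rewrite coefD mul_polyC coefZ !coef_map /= [q`_n]nth_default // mulr0 addr0.
have [sz ct] := subst_top polyC F szf; apply/eqP; rewrite eqn_leq sz ltnNge /=.
apply/negP => /(nth_default 0)/eqP; rewrite ct fn horner_map polyC_eq0.
by rewrite (negPf ld).
Qed.

Lemma size_swapZ r H : r != 0 -> H != 0 ->
  size (swapXY (r *: H)) = (size r + size (swapXY H)).-1.
Proof.
move=> r0 H0; rewrite -mul_polyC rmorphM /= swapXY_polyC size_mul ?size_map_polyC //.
  by rewrite map_polyC_eq0.
by rewrite swapXY_eq0.
Qed.

Lemma tdeg_ge3 j : (3 <= tdeg n (Fs j))%N.
Proof.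
apply: leq_trans hn3 _; apply: leq_trans (tdeg_size n (hdeg j)).
by apply: leq_pmulr; case: (size (Fs j)) (hdeg j) => [|[]].
Qed.

Lemma swap_irreducible H : irreducible_elt H -> (1 < size (swapXY H))%N ->
  irreducible_poly (map_poly tofrac (swapXY H)).
Proof. by move=> irrH szH; apply/irreducible_elt_tofrac/irreducible_elt_swap. Qed.

Section AtPoint.
Variables (i : 'I_m) (t0 : k) (l r : {poly k}).
Hypotheses (t00 : t0 != 0) (szl : (size l <= n.+1)%N)
  (ld : forall j, (tlead n (Fs j)).[l`_n] != 0)
  (Fl : (Fs i).[l] = ('X - t0%:P) ^+ 2 * r)
  (dFl : (Fs i)^`().[l].[t0] != 0)
  (Fjl : forall j, j != i -> (Fs j).[l].[t0] != 0).

(** The case [e = 2]. With [q] removed, the pencils are irreducible, pairwise non-associate and of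
    degree less than [p] in [t], so their product is separable over [k(s)] and stays so at almost
    every [s = c]. *)
Lemma tangent_pencil : exists c Psi,
  [/\ \prod_j (Fs j).[l + c%:P * ('X - t0%:P) ^+ 2] = ('X - t0%:P) ^+ 2 * Psi,
      separable_poly Psi & Psi.[t0] != 0].
Proof.
set q := ('X - t0%:P) ^+ 2.
have q0 : q != 0 by rewrite monic_neq0 // monic_exp // monicXsubC.
have qt0 : q.[t0] = 0 by rewrite horner_exp hornerXsubC subrr expr0n.
have qu u : u != t0 -> q.[u] != 0 by move=> h; rewrite horner_exp hornerXsubC expf_neq0 // subr_eq0.
have szq : size q = 3 by rewrite size_exp_XsubC.
have [Hi HiE evHi] := pencil_quot Fl qt0.
(* At [t0] only [Fs i] vanishes on [l], so [q] is removed from its pencil alone. *)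
pose H j := if j == i then Hi else pencil q l (Fs j).
pose d j := if j == i then q else 1.
have HE j : pencil q l (Fs j) = d j *: H j.
  by rewrite /d /H; case: eqP => [->|_]; rewrite ?scale1r.
have d0 j : d j != 0 by rewrite /d; case: ifP; rewrite ?oner_neq0.
have evH j : ev t0 (H j) != 0.
  rewrite /H; have [ji|ji] := eqVneq j i; last first.
    rewrite /pencil map_comp_poly rmorphD /= map_polyZ /= map_polyC /= /horner_eval qt0.
    by rewrite scale0r add0r comp_polyCr polyC_eq0 -ev_horner Fjl.
  rewrite evHi; apply: contraNneq dFl => /(congr1 (fun P : {poly k} => P`_1)).
  by rewrite coefD coefCM coefX coefC coef0 add0r mulr1 => ->.
have Hprim j : primitive2 (H j).
  move=> u; have [->//|ut] := eqVneq u t0.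
  by apply: (ev_pencil_neq0 (Fprim j) (HE j)); apply: qu.
have H0 j : H j != 0 by apply: contraNneq (Hprim j 0) => ->; rewrite rmorph0.
have Hirr j : irreducible_elt (H j).
  exact: (pencil_irreducible q0 (d0 j) (hirr j) (hdeg j) (HE j) (Hprim j)).
have szH j : (size (swapXY (H j)) + (size (d j)).-1 = (tdeg n (Fs j)).+1)%N.
  rewrite -(size_swap_pencil (q := q) szl _ (ld j)) ?szq // HE size_swapZ //.
  have : (0 < size (d j))%N by rewrite size_poly_gt0.
  by case: (size (d j)) => // s _; rewrite addnC.
have szd j : (size (d j) <= 3)%N by rewrite /d; case: ifP; rewrite ?szq ?size_poly1.
have szH1 j : (1 < size (swapXY (H j)))%N.
  rewrite -(leq_add2r (size (d j)).-1) szH.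
  by apply: leq_trans (_ : 4 <= _)%N; [case: (size (d j)) (szd j) => [|[|[|[]]]] | rewrite ltnS tdeg_ge3].
have szHp j : (size (swapXY (H j)) <= p)%N.
  by apply: leq_trans (hp j); rewrite -szH leq_addr.
have sepH : separable_poly (map_poly tofrac (\prod_j swapXY (H j))).
  rewrite rmorph_prod; apply: (separable_prod_irreducible pchar_fraction) => [j|j|j1 j2 j12].
  - exact: swap_irreducible.
  - by rewrite size_map_tofrac.
  apply/negP => HH; apply: (hnassoc j12).
  apply: (pencil_associated q0 (d0 j1) (d0 j2) (Fprim j1) (Fprim j2) (HE j1) (HE j2)).
  apply: associated_swap; apply: eqp_associated HH.
    exact: irreducible_elt_primitive (irreducible_elt_swap (Hirr j1)).
  exact: irreducible_elt_primitive (irreducible_elt_swap (Hirr j2)).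
have [e e0 esep] := generic_separable sepH.
(* The second factor prevents [t0] from being a root of the quotient at [s = c]. *)
have [c] : exists c, (e * \prod_j ev t0 (H j)).[c] != 0.
  by apply: exists_nonroot; rewrite mulf_neq0 //; apply/prodf_neq0 => j _.
rewrite hornerM mulf_eq0 negb_or horner_prod => /andP[ec evHc].
exists c, (ev c (\prod_j swapXY (H j))); split; last first.
- rewrite rmorph_prod horner_prod; apply/prodf_neq0 => j _.
  by rewrite -ev_swapC; move/prodf_neq0: evHc => ->.
- exact: esep.
have FE j : (Fs j).[l + c%:P * q] = d j * ev c (swapXY (H j)).
  rewrite -ev_swap_pencil HE -mul_polyC rmorphM /= swapXY_polyC rmorphM /=.
  by rewrite -map_poly_comp map_poly_id // => x _ /=; rewrite /horner_eval hornerC.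
under eq_bigr do rewrite FE.
rewrite big_split /= rmorph_prod; congr (_ * _).
rewrite (bigD1 i) //= big1 ?mulr1 /d ?eqxx // => j /negPf ->.
by [].
Qed.

(** The case [e = 1], normalized so that [l' + s q] has constant coefficient [s], to be matched with
    [a_0]. Since [t0 != 0], the value of [q] at 0 can be scaled to 1, and changing [l] by a multiple
    of [q] keeps its value at [t0]. *)
Lemma secant_pencil : exists q l' H, [/\ (size q <= n)%N /\ (size l' <= n.+1)%N,
  l'`_n = l`_n, q`_0 = 1 /\ l'`_0 = 0,
  pencil q l' (Fs i) = q *: H /\ q %= 'X - t0%:P &
  irreducible_poly (map_poly tofrac (swapXY H)) /\ (3 <= size (swapXY H))%N].
Proof.
pose b := - t0^-1; have b0 : b != 0 by rewrite oppr_eq0 invr_eq0.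
pose q := b *: ('X - t0%:P); pose l' := l - l.[0] *: q.
have qX : q %= 'X - t0%:P by rewrite eqp_scale.
have q0 : q != 0 by rewrite scaler_eq0 (negPf b0) polyXsubC_eq0.
have szq : size q = 2 by rewrite size_scale // size_XsubC.
have qt0 : q.[t0] = 0 by rewrite hornerZ hornerXsubC subrr mulr0.
have q_0 : q`_0 = 1.
  by rewrite coefZ coefB coefX coefC /= sub0r /b mulrNN mulVf.
have qu u : u != t0 -> q.[u] != 0.
  by move=> h; rewrite hornerZ hornerXsubC mulf_neq0 // subr_eq0.
have szqn : (size q <= n)%N by rewrite szq ltnW.
have szlq : (size (l.[0] *: q) <= n)%N by rewrite (leq_trans (size_scale_leq _ _)).
have szl' : (size l' <= n.+1)%N.
  by rewrite (leq_trans (size_polyD _ _)) // geq_max szl size_polyN leqW.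
have l't0 : l'.[t0] = l.[t0] by rewrite hornerD hornerN hornerZ qt0 mulr0 subr0.
have l'n : l'`_n = l`_n by rewrite coefB [(l.[0] *: q)`_n]nth_default // subr0.
have /factor_theorem[g gE] : root (Fs i).[l'] t0.
  rewrite /root ev_horner l't0 -ev_horner Fl hornerM horner_exp hornerXsubC subrr.
  by rewrite expr0n mul0r.
have Fl' : (Fs i).[l'] = q * (b^-1 *: g).
  by rewrite gE -scalerAl -scalerAr scalerA divff // scale1r mulrC.
have [H HE evH] := pencil_quot Fl' qt0.
have Hprim : primitive2 H.
  move=> u; have [->|ut] := eqVneq u t0; last exact: (ev_pencil_neq0 (Fprim i) HE (qu u ut)).
  rewrite evH; apply: contraNneq dFl => /(congr1 (fun P : {poly k} => P`_1)).
  by rewrite coefD coefCM coefX coefC coef0 add0r mulr1 ev_horner l't0 -ev_horner => ->.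
have H0 : H != 0 by apply: contraNneq (Hprim 0) => ->; rewrite rmorph0.
have szH : size (swapXY H) = tdeg n (Fs i).
  have := size_swap_pencil (F := Fs i) szl' szqn; rewrite l'n => /(_ (ld i)).
  by rewrite HE size_swapZ // szq => -[].
have szH3 : (3 <= size (swapXY H))%N by rewrite szH tdeg_ge3.
exists q, l', H; split=> //.
  by split=> //; rewrite coefB coefZ q_0 mulr1 -horner_coef0 subrr.
split=> //; apply: swap_irreducible; last exact: ltnW.
exact: (pencil_irreducible q0 q0 (hirr i) (hdeg i) HE Hprim).
Qed.
End AtPoint.
End Family.
End Tangent.

(** * Specializations of the generic polynomial *)

Section GenericPoly.
Variables (k : fieldType) (n : nat).
Local Notation K := (ratT k n.+1).
Implicit Types F : {poly {poly k}}.

Lemma subst_genE F : subst_gen n F = subst (@embk k n.+1) F (genpoly k n).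
Proof. by []. Qed.

Lemma genpolyE : genpoly k n = \poly_(j < n.+1) avar k n.+1 j.
Proof. by rewrite poly_def; apply: eq_bigr => j _; rewrite mul_polyC. Qed.

Lemma size_genpoly : (size (genpoly k n) <= n.+1)%N.
Proof. by rewrite genpolyE size_poly. Qed.

Lemma tlead_generic (P : {poly k}) : P != 0 ->
  (map_poly (@embk k n.+1) P).[(genpoly k n)`_n] != 0.
Proof.
move=> P0; rewrite genpolyE coef_poly ltnSn [avar _ _ _]/= eqxx.
have -> : map_poly (@embk k n.+1) P = map_poly tofrac (map_poly polyC (map_poly (@embk k n) P)).
  by rewrite -!map_poly_comp.
rewrite horner_map tofrac_eq0 -[_.[_]]/(_ \Po 'X) comp_polyXr.
by rewrite map_poly_eq0.
Qed.

Lemma size_subst_gen F : F != 0 -> size (subst_gen n F) = (tdeg n F).+1.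
Proof.
move=> F0; have [sz ct] := subst_top (@embk k n.+1) F size_genpoly.
apply/eqP; rewrite eqn_leq sz ltnNge; apply/negP => /(nth_default 0)/eqP.
by rewrite ct (negPf (tlead_generic (tlead_neq0 n F0))).
Qed.

(** Made monic so that a monic lift to a valuation ring shows its roots to be integral. *)
Definition monic_gen F := (lead_coef (subst_gen n F))^-1 *: subst_gen n F.

Lemma lead_subst_gen F : F != 0 -> lead_coef (subst_gen n F) != 0.
Proof. by move=> F0; rewrite lead_coef_eq0 -size_poly_eq0 size_subst_gen. Qed.

Lemma monic_gen_eqp F : F != 0 -> monic_gen F %= subst_gen n F.
Proof. by move=> F0; rewrite eqp_scale // invr_eq0 lead_subst_gen. Qed.

Lemma monic_gen_monic F : F != 0 -> monic_gen F \is monic.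
Proof. by move=> F0; rewrite monicE lead_coefZ mulVf // lead_subst_gen. Qed.

Lemma size_monic_gen F : F != 0 -> size (monic_gen F) = (tdeg n F).+1.
Proof. by move=> F0; rewrite (eqp_size (monic_gen_eqp F0)) size_subst_gen. Qed.

(** A place of [K] taking the generic polynomial to [f] and extending [e] on constants, presented by
    its valuation ring [spR] and a lift [spF] of the generic polynomial. *)
Record specialization (K' : fieldType) (e : {rmorphism k -> K'}) (f : {poly K'}) := Specialization {
  spR : comNzRingType;
  spI : {rmorphism spR -> K};
  spS : {rmorphism spR -> K'};
  spE : {rmorphism k -> spR};
  spF : {poly spR};
  sp_inj : injective spI;
  sp_val : forall x, (exists a, spI a = x) \/ (exists2 a, spI a = x^-1 & spS a = 0);
  sp_IE : spI \o spE =1 @embk k n.+1;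
  sp_SE : spS \o spE =1 e;
  sp_IF : map_poly spI spF = genpoly k n;
  sp_SF : map_poly spS spF = f;
  sp_size : (size spF <= n.+1)%N }.

Lemma specialization_of_place (K' : fieldType) (e : {rmorphism k -> K'}) (al : nat -> K')
    (R : K -> K' -> Prop) :
    place_rel R -> (forall c, R (embk n.+1 c) (e c)) ->
    (forall j, (j <= n)%N -> R (avar k n.+1 j) (al j)) ->
  exists S : specialization e (\poly_(j < n.+1) al j),
    forall x y, R x y <-> exists2 a, spI S a = x & spS S a = y.
Proof.
move=> [hR Rv] Re Ra.
have [A [i [sp [eA [i_inj RP ie se]]]]] := ring_rel_hom hR Re.
have /choice[a aP] : forall j, exists a, (j <= n)%N -> i a = avar k n.+1 j /\ sp a = al j.
  move=> j; have [jn|_] := leqP j n; last by exists 0.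
  by have [a ia sa] := (RP _ _).1 (Ra j jn); exists a.
have mapE (B : nzRingType) (h : {rmorphism A -> B}) (b : nat -> B) :
    (forall j, (j <= n)%N -> h (a j) = b j) ->
    map_poly h (\poly_(j < n.+1) a j) = \poly_(j < n.+1) b j.
  move=> hb; apply/polyP => j; rewrite coef_map !coef_poly; case: ltnP => [jn|_].
    exact: hb.
  exact: raddf0.
have i_val x : (exists a, i a = x) \/ (exists2 a, i a = x^-1 & sp a = 0).
  have [[y /RP[b ib _]]|/RP[b ib sb]] := Rv x; first by left; exists b.
  by right; exists b.
have iF : map_poly i (\poly_(j < n.+1) a j) = genpoly k n.
  by rewrite genpolyE; apply: mapE => j /aP[].
have sF : map_poly sp (\poly_(j < n.+1) a j) = \poly_(j < n.+1) al j.
  by apply: mapE => j /aP[].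
by exists (Specialization i_inj i_val ie se iF sF (size_poly _ _)).
Qed.

Section Specialized.
Variables (K' : fieldType) (e : {rmorphism k -> K'}) (f : {poly K'}) (S : specialization e f).
Local Notation A := (spR S).
Local Notation i := (spI S).
Local Notation sp := (spS S).

Lemma sp_unit a : sp a != 0 -> exists b, b * a = 1.
Proof.
move=> sa; have a0 : i a != 0.
  apply: contraNneq sa => ia0; rewrite -(rmorph0 sp); apply/eqP; congr (sp _).
  by apply: (@sp_inj _ _ _ S); rewrite ia0 rmorph0.
have [[b ib]|[b ib sb]] := sp_val S (i a)^-1.
  by exists b; apply: (@sp_inj _ _ _ S); rewrite rmorphM ib rmorph1 mulVf.
rewrite invrK in ib; move: sb sa; rewrite (@sp_inj _ _ _ S _ _ ib) => ->.
by rewrite eqxx.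
Qed.

Lemma sp_subst F : map_poly sp (subst (spE S) F (spF S)) = subst e F f.
Proof. by rewrite (map_subst _ _ (@sp_SE _ _ _ S)) sp_SF. Qed.

(** The top coefficient of the lift has nonzero residue, hence is a unit of the valuation ring;
    dividing by it gives a monic lift of [monic_gen F]. *)
Lemma sp_monic F : F != 0 -> (map_poly e (tlead n F)).[f`_n] != 0 ->
  exists b (P : {poly A}), [/\ P = b *: subst (spE S) F (spF S), sp b != 0, P \is monic &
     map_poly i P = monic_gen F].
Proof.
move=> F0 ld; have [sz ct] := subst_top (spE S) F (sp_size S).
have szf : (size f <= n.+1)%N by rewrite -(sp_SF S) (leq_trans (size_poly _ _)) ?sp_size.
have [_ ct'] := subst_top e F szf.
set P := subst (spE S) F (spF S) in sz ct *.
have [b bP] : exists b, b * P`_(tdeg n F) = 1.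
  by apply: sp_unit; rewrite -coef_map sp_subst ct'.
have Pm : b *: P \is monic.
  have szbP : size (b *: P) = (tdeg n F).+1.
    apply/eqP; rewrite eqn_leq (leq_trans (size_scale_leq _ _)) //= ltnNge.
    by apply/negP => /(nth_default 0)/eqP; rewrite coefZ bP oner_eq0.
  by rewrite monicE lead_coefE szbP coefZ bP.
exists b, (b *: P); split=> //.
  apply/eqP => sb; have := congr1 sp bP; rewrite rmorphM rmorph1 sb mul0r => /eqP.
  by rewrite eq_sym oner_eq0.
have iP : map_poly i (b *: P) = i b *: subst_gen n F.
  by rewrite map_polyZ /= (map_subst _ _ (@sp_IE _ _ _ S)) sp_IF.
have := monic_map i Pm; rewrite iP monicE lead_coefZ => /eqP ibE.
by rewrite /monic_gen -[(lead_coef _)^-1]mul1r -ibE mulfK ?lead_subst_gen.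
Qed.
End Specialized.
End GenericPoly.

(** * Specialization along a line with varying constant coefficient *)

Section TangentSpecialization.
Variables (k : closedFieldType) (n : nat).
Implicit Types F : {poly {poly k}}.
Local Notation K := (ratT k n.+1).
Local Notation ev u := (map_poly (horner_eval u)).

Lemma subst_horner (R : comNzRingType) (e : {rmorphism k -> R}) F (f : {poly R}) (t : k) :
  (subst e F f).[e t] = (map_poly e (ev t F)).[f.[e t]].
Proof.
rewrite /subst -[f.[e t]]/(horner_eval (e t) f) -[LHS]/(horner_eval (e t) _) -horner_map /=.
congr (_.[_]); rewrite -!map_poly_comp; apply: eq_map_poly => q /=.
by rewrite /horner_eval horner_map.
Qed.

Lemma embk1_comp (Q z : {poly k}) :
  (map_poly (@embk k 1) Q).[tofrac z] = tofrac (Q \Po z).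
Proof.
have -> : map_poly (@embk k 1) Q = map_poly tofrac (map_poly polyC Q) by rewrite -map_poly_comp.
exact: horner_map.
Qed.

(** The place is composed of a place onto [k(a_0)], along the line on which only the constant
    coefficient of [f] varies, and of evaluation at the actual constant coefficient [c].
    Divisibility by [pi = a_0 - c] can be tested in [k(a_0)]. The last clause computes the order of
    vanishing of [F(t, f)], for fixed [t], on the line. *)
Lemma tangent_specialization (f : {poly k}) : (size f <= n.+1)%N ->
  exists (S : specialization n (idfun : {rmorphism k -> k}) f) (pi : spR S),
  [/\ pi != 0, spS S pi = 0, forall a, spS S a = 0 -> exists b, a = pi * b &
      forall F t p1, ev t F \Po ('X + (f.[t] - f`_0)%:P) = ('X - (f`_0)%:P) * p1 ->
        exists d, (subst (spE S) F (spF S)).[spE S t] = pi * d /\ spS S d = p1.[f`_0]].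
Proof.
move=> szf; set c := f`_0.
pose g : {poly {poly k}} := map_poly polyC (f - c%:P) + 'X%:P.
pose al j : ratT k 1 := tofrac g`_j.
have gE j : g`_j = (f`_j - c *+ (j == 0%N))%:P + 'X *+ (j == 0%N).
  rewrite coefD coef_map coefB !coefC /=.
  by case: (j =P 0%N) => _; rewrite ?mulr1n ?mulr0n ?subr0.
have al0 : al 0%N = avar k 1 0 by rewrite /al gE !mulr1n subrr add0r.
have alS j : (0 < j)%N -> al j = @embk k 1 f`_j.
  by move=> j0; rewrite /al gE gtn_eqF // !mulr0n subr0 addr0.
have [R [Rp _ Re Ra]] := tower_place n al0.
have [S1 RP] := specialization_of_place Rp Re Ra.
have Sp := spec_rel_place c.
pose R' := fun (x : K) (z : k) => exists2 y, R x y & spec_rel c y z.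
have R'p : place_rel R' by apply: place_comp.
have R'e b : R' (embk n.+1 b) b.
  exists (embk 1 b) => //; have := spec_rel_tofrac c b%:P; by rewrite hornerC.
have R'a j : (j <= n)%N -> R' (avar k n.+1 j) f`_j.
  move=> jn; exists (al j); first exact: Ra.
  have := spec_rel_tofrac c g`_j; rewrite -/(al j) gE.
  case: j jn => [|j] jn /=; rewrite ?mulr1n ?mulr0n ?subr0 ?subrr ?add0r ?addr0.
    by rewrite hornerX.
  by rewrite hornerC.
have [S] := @specialization_of_place k n k idfun (fun j => f`_j) R' R'p R'e R'a.
have fE : \poly_(j < n.+1) f`_j = f.
  by apply/polyP => j; rewrite coef_poly; case: ltnP => // jn; rewrite nth_default // (leq_trans szf).
move: S; rewrite fE => S SP.
have [[_ RB RM _] _] := Rp; have [[_ SB SM _] _] := Sp.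
pose w : K := avar k n.+1 0 - embk n.+1 c.
pose w1 : ratT k 1 := tofrac ('X - c%:P).
have Rw : R w w1.
  have -> : w1 = avar k 1 0 - embk 1 c by rewrite /w1 rmorphB.
  by rewrite -al0; apply: RB; [apply: Ra | apply: Re].
have Xc0 : 'X - c%:P != 0 :> {poly k} by rewrite polyXsubC_eq0.
have w10 : w1 != 0 by rewrite tofrac_eq0.
have Rw' : R w^-1 w1^-1 by apply: place_inv.
have w0 : w != 0.
  apply: contraNneq w10 => w0; apply/eqP; have [[_ _ _ R0] _] := Rp.
  by apply: R0; rewrite -w0.
have [pi piw pi0] : exists2 pi, spI S pi = w & spS S pi = 0.
  apply/SP; exists w1 => //; have := spec_rel_tofrac c ('X - c%:P).
  by rewrite hornerXsubC subrr.
(* If the quotient by [pi] has a value in the local ring of [k(a_0)] at [c], it lies in the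
   valuation ring. *)
have piI a x b y : spI S a = x -> R (x / w) y -> spec_rel c y b ->
    exists d, a = pi * d /\ spS S d = b.
  move=> ax Rxw yb; have [|d dx db] := (SP (x / w) b).1; first by exists y.
  exists d; split=> //; apply: (@sp_inj _ _ _ _ _ S).
  by rewrite rmorphM piw dx ax mulrCA divff ?mulr1.
exists S, pi; split=> //.
- by apply: contraNneq w0 => h; rewrite -piw h rmorph0.
- move=> a sa0; have [|y Rxy [N [D [D0 yE]]]] := (SP (spI S a) 0).2; first by exists a.
  move=> /esym/eqP; rewrite mulf_eq0 invr_eq0 (negPf D0) orbF => /factor_theorem[N1 NE].
  have [||d [-> _]] := piI a (spI S a) (N1.[c] / D.[c]) (tofrac N1 / tofrac D) erefl; last by exists d.
    have -> : tofrac N1 / tofrac D = y / w1.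
      by rewrite yE NE rmorphM /= mulrAC mulfK.
    exact: RM.
  by exists N1, D.
move=> F t p1 Fp1.
pose P1 := (subst (spE S1) F (spF S1)).[spE S1 t].
pose P := (subst (spE S) F (spF S)).[spE S t].
have IE (K' : fieldType) (e : {rmorphism k -> K'}) f' (S' : specialization n e f') :
    spI S' (subst (spE S') F (spF S')).[spE S' t] = (subst_gen n F).[embk n.+1 t].
  rewrite -horner_map /= (map_subst _ _ (@sp_IE _ _ _ _ _ S')) sp_IF.
  by have /= -> := @sp_IE _ _ _ _ _ S' t.
have P1S : spS S1 P1 = tofrac (('X - c%:P) * p1).
  rewrite /P1 -horner_map /= sp_subst.
  have -> : spS S1 (spE S1 t) = @embk k 1 t := @sp_SE _ _ _ _ _ S1 t.
  rewrite (subst_horner (@embk k 1) F (\poly_(j < n.+1) al j) t).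
  have -> : (\poly_(j < n.+1) al j).[@embk k 1 t] = tofrac ('X + (f.[t] - c)%:P).
    have -> : \poly_(j < n.+1) al j = map_poly tofrac g.
      apply/polyP => j; rewrite coef_map coef_poly; case: ltnP => // jn.
      rewrite gE gtn_eqF ?(leq_ltn_trans _ jn) // !mulr0n subr0 addr0.
      by rewrite nth_default ?(leq_trans szf) // rmorph0.
    have /= -> := horner_map tofrac g t%:P.
    by rewrite hornerD hornerC horner_map /= hornerD hornerN hornerC addrC.
  by rewrite embk1_comp Fp1.
apply: (piI P (spI S P) p1.[c] (tofrac p1) erefl); last exact: spec_rel_tofrac.
rewrite IE -(IE _ _ _ S1) -/P1.
have -> : tofrac p1 = tofrac (('X - c%:P) * p1) / w1 by rewrite rmorphM /= mulrAC divff ?mul1r.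
by apply: RM => //; apply/RP; exists P1.
Qed.
End TangentSpecialization.

(** * The Galois group *)

Lemma scale_mulCA (E : fieldType) (a b : E) (P Q : {poly E}) :
  a *: (b%:P * P * Q) = P * ((a * b) *: Q).
Proof. by rewrite -!mul_polyC polyCM; ring. Qed.

Section Specializations.
Variables (k : closedFieldType) (n : nat).
Implicit Types F : {poly {poly k}}.

(** The [a_j] go to the coefficients of [l + s q] with [s = a_0]; the conditions on the constant
    coefficients let [a_0] go to itself. *)
Lemma pencil_specialization (q l : {poly k}) :
    (size q <= n)%N -> (size l <= n.+1)%N -> q`_0 = 1 -> l`_0 = 0 ->
  exists (f : {poly ratT k 1}) (S : specialization n (@embk k 1) f),
    (forall F, subst (@embk k 1) F f = map_poly tofrac (swapXY (pencil q l F))) /\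
    forall P : {poly k}, P.[l`_n] != 0 -> (map_poly (@embk k 1) P).[f`_n] != 0.
Proof.
move=> szq szl q0 l0; pose g := map_poly polyC l + 'X%:P * map_poly polyC q.
pose al j : ratT k 1 := tofrac g`_j.
have gE j : g`_j = (l`_j)%:P + 'X * (q`_j)%:P by rewrite coefD coefCM !coef_map.
have al0 : al 0%N = avar k 1 0 by rewrite /al gE q0 l0 polyC0 add0r mulr1.
have [R [Rp _ Re Ra]] := tower_place n al0.
have [S _] := specialization_of_place Rp Re Ra.
have fE : \poly_(j < n.+1) al j = map_poly tofrac g.
  apply/polyP => j; rewrite coef_map coef_poly; case: ltnP => // jn.
  by rewrite gE !nth_default ?polyC0 ?mulr0 ?addr0 ?rmorph0 // (leq_trans _ jn) // leqW.
exists (\poly_(j < n.+1) al j), S; split=> [F|P Pl].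
  rewrite fE swap_pencil; symmetry; exact: map_subst.
rewrite fE coef_map gE [q`_n]nth_default // polyC0 mulr0 addr0 /=.
have /= -> := horner_map (@embk k 1) P l`_n.
by rewrite /upr tofrac_eq0 polyC_eq0.
Qed.
End Specializations.

(** * Symmetries of the roots *)

Section Main.
Variables (p : nat) (k : closedFieldType) (m n : nat) (Fs : 'I_m -> {poly {poly k}}).
Hypotheses (hchar : p \in [pchar k]) (hdeg : forall j, (1 < size (Fs j))%N)
  (hirr : forall j, irreducible_elt (Fs j))
  (hnassoc : forall i j, i != j -> ~ associated (Fs i) (Fs j))
  (hn3 : (3 <= n)%N) (hp : forall j, (tdeg n (Fs j) < p)%N).
Local Notation K := (ratT k n.+1).
Local Notation M j := (monic_gen n (Fs j)).
Implicit Types j : 'I_m.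
Variables (L : splittingFieldType K) (rs : 'I_m -> seq L).
Hypotheses (rsE : forall j, map_poly (in_alg L) (M j) = \prod_(x <- rs j) ('X - x%:P)).
Local Notation Gal := ('Gal({:L} / 1)%g).

Let F0 j : Fs j != 0.
Proof. by have [] := hirr j. Qed.

Let rsP j (S : comNzRingType) (i : {rmorphism S -> K}) (P : {poly S}) : map_poly i P = M j ->
  map_poly (in_alg L \o i) P = \prod_(x <- rs j) ('X - x%:P).
Proof. by move=> PE; rewrite map_poly_comp /= PE rsE. Qed.

(** The case [e = 0], for all the factors in one specialization so that distinct factors can be
    compared. The constant coefficient of [l] is subtracted to make [a_0] the parameter. *)
Lemma irreducible_pencil_specialization j : exists (f : {poly ratT k 1}) (S : specialization n (@embk k 1) f)
    (l : {poly k}),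
  forall j' : 'I_m, exists b (P : {poly spR S}), [/\ spS S b != 0, P \is monic, map_poly (spI S) P = M j',
    map_poly (spS S) P = spS S b *: map_poly tofrac (swapXY (pencil 1 l (Fs j'))) &
    irreducible_elt (pencil 1 l (Fs j')) /\ (1 < size (swapXY (pencil 1 l (Fs j'))))%N].
Proof.
have [t0 [l [r [[_ szl] ld _ _ _]]]] := tangent_exists hchar hdeg hirr hnassoc hn3 hp j.
pose l' := l - (l`_0)%:P.
have n0 : (0 < n)%N by apply: leq_trans hn3.
have szl' : (size l' <= n.+1)%N.
  by rewrite (leq_trans (size_polyD _ _)) // geq_max szl size_polyN (leq_trans (size_polyC_leq1 _)).
have l'n : l'`_n = l`_n by rewrite coefB coefC; case: (n) n0 => // ? _; rewrite subr0.
have sz1 : (size (1%R : {poly k}) <= n)%N by rewrite size_poly1.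
have [||f [S [SE Sl]]] := pencil_specialization sz1 szl'.
- by rewrite coef1.
- by rewrite coefB coefC subrr.
exists f, S, l' => j'.
have [|b [P [PE b0 Pm iP]]] := sp_monic S (F0 j'); first by apply: Sl; rewrite l'n.
exists b, P; split=> //.
  by rewrite PE map_polyZ /= sp_subst SE.
split; first by apply: family_irreducible => // u; rewrite hornerC oner_neq0.
by rewrite (size_swap_pencil szl' sz1) ?l'n // ltnS (leq_trans _ (tdeg_ge3 hdeg hn3 j')).
Qed.

Lemma monic_gen_irreducible j : irreducible_poly (M j).
Proof.
have [f [S [l /(_ j)[b [P [b0 Pm iP sP [irr sz]]]]]]] := irreducible_pencil_specialization j.
rewrite -iP; apply: (irreducible_of_spec (@sp_inj _ _ _ _ _ S) (sp_val S) Pm (rsP iP)).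
rewrite sP; apply: irreducible_eqp (swap_irreducible irr sz).
by rewrite eqp_sym eqp_scale.
Qed.

(** Equal monic polynomials have equal lifts; their specializations would make the two pencils, and
    so [Fs j1] and [Fs j2], associated. *)
Lemma monic_gen_neq j1 j2 : j1 != j2 -> ~~ (M j1 %= M j2).
Proof.
move=> j12; have [f [S [l hS]]] := irreducible_pencil_specialization j1.
have [b1 [P1 [b10 Pm1 iP1 sP1 [irr1 sz1]]]] := hS j1.
have [b2 [P2 [b20 Pm2 iP2 sP2 [irr2 sz2]]]] := hS j2.
rewrite eqp_monic ?monic_gen_monic //; apply/negP => /eqP M12.
have P12 : P1 = P2.
  by apply: (map_inj_poly (@sp_inj _ _ _ _ _ S) (rmorph0 _)); rewrite iP1 iP2.
apply: (hnassoc j12).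
have Fprim j : primitive2 (Fs j) by apply: irreducible_elt_primitive.
have o0 : (1 : {poly k}) != 0 by rewrite oner_neq0.
apply: (@pencil_associated _ 1 l 1 1 (Fs j1) (Fs j2) (pencil 1 l (Fs j1)) (pencil 1 l (Fs j2)) o0 o0 o0);
  rewrite ?scale1r //.
apply: associated_swap; apply: eqp_associated.
- exact: irreducible_elt_primitive (irreducible_elt_swap irr1).
- exact: irreducible_elt_primitive (irreducible_elt_swap irr2).
have : spS S b1 *: map_poly tofrac (swapXY (pencil 1 l (Fs j1))) %=
       spS S b2 *: map_poly tofrac (swapXY (pencil 1 l (Fs j2))).
  by rewrite -sP1 -sP2 P12 eqpxx.
by rewrite (eqp_ltrans (eqp_scale _ b10)) (eqp_rtrans (eqp_scale _ b20)).
Qed.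

Lemma monic_gen_separable : separable_poly (\prod_j M j).
Proof.
have pK : p \in [pchar K] by rewrite (rmorph_pchar (@embk k n.+1)).
apply: (separable_prod_irreducible pK) => [j|j|j1 j2].
- exact: monic_gen_irreducible.
- by rewrite size_monic_gen.
- exact: monic_gen_neq.
Qed.

Definition all_roots := flatten [seq rs j | j <- enum 'I_m].

Lemma all_rootsE : map_poly (in_alg L) (\prod_j M j) = \prod_(x <- all_roots) ('X - x%:P).
Proof.
rewrite rmorph_prod big_flatten big_map big_enum /=.
by apply: eq_bigr => j _; rewrite rsE.
Qed.

Lemma mem_all_roots x : reflect (exists j, x \in rs j) (x \in all_roots).
Proof.
apply: (iffP flattenP) => [[_ /mapP[j _ ->] xj]|[j xj]]; first by exists j.
by exists (rs j) => //; apply/mapP; exists j; rewrite ?mem_enum.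
Qed.

Lemma all_roots_uniq : uniq all_roots.
Proof. by rewrite -separable_prod_XsubC -all_rootsE separable_map monic_gen_separable. Qed.

Lemma roots_uniq j : uniq (rs j).
Proof.
rewrite -separable_prod_XsubC -rsE separable_map.
have := monic_gen_separable; rewrite (bigD1 j) //= separable_mul.
by case/and3P.
Qed.

Lemma roots_disjoint j1 j2 x : x \in rs j1 -> x \in rs j2 -> j1 = j2.
Proof.
move=> x1 x2; apply/eqP/negPn/negP => j12.
have := monic_gen_separable; rewrite (bigD1 j1) //= (bigD1 j2) 1?eq_sym //=.
rewrite separable_mul coprimepMr -(coprimep_map (in_alg L)) !rsE => /and3P[_ _ /andP[cop _]].
have := coprimep_root (x := x) cop; rewrite root_prod_XsubC => /(_ x1).
by rewrite -/(root _ _) root_prod_XsubC x2.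
Qed.

Hypothesis rs_span : <<1 & all_roots>>%VS = fullv.

Lemma galoisL : galois 1 {:L}.
Proof.
apply/splitting_galoisField; exists (map_poly (in_alg L) (\prod_j M j)); split.
- by apply/polyOverP => d; rewrite coef_map; apply/vlineP; exists (\prod_j M j)`_d.
- by rewrite separable_map monic_gen_separable.
by exists all_roots; [rewrite all_rootsE eqpxx | apply: rs_span].
Qed.

Lemma gal_trivial (g : gal_of {:L}) : (forall x, x \in all_roots -> g x = x) -> g = 1%g.
Proof.
move=> gx; apply/eqP/gal_eqP => x _; rewrite gal_id.
have : x \in <<1 & all_roots>>%VS by rewrite rs_span memvf.
have : all [in all_roots] all_roots by apply/allP.
elim/last_ind: {2 3}all_roots x => [|s y IH] x.
  rewrite Fadjoin_nil => _ /vlineP[c ->].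
  by rewrite linearZ /= rmorph1.
rewrite all_rcons adjoin_rcons => /andP[yr sr] /Fadjoin_polyP[P Ps ->].
rewrite -horner_map /= gx //; congr (_.[_]).
apply/polyP => d; rewrite coef_map /=; apply: IH => //.
exact: (polyOverP Ps).
Qed.

Lemma roots_two_transitive j x y x' y' : x \in rs j -> y \in rs j -> x' \in rs j -> y' \in rs j ->
  x != y -> x' != y' -> exists2 g, g \in Gal & g x = x' /\ g y = y'.
Proof.
have [t0 [l [r [[t00 szl] ld Fl dFl Fjl]]]] := tangent_exists hchar hdeg hirr hnassoc hn3 hp j.
have [q [l' [H [[szq szl'] l'n [q_0 l'_0] [HE qX] [irrH szH]]]]] :=
  secant_pencil hdeg hirr hn3 t00 szl ld Fl dFl.
have [f [S [SE Sl]]] := pencil_specialization szq szl' q_0 l'_0.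
have [|b [P [PE b0 Pm iP]]] := sp_monic S (F0 j); first by apply: Sl; rewrite l'n.
have [cq cq0 qE] : exists2 c : k, c != 0 & q = c%:P * ('X - t0%:P).
  by have /eqpf_eq[c c0 ->] := qX; exists c; rewrite ?mul_polyC.
pose H' := (spS S b * @embk k 1 cq) *: map_poly tofrac (swapXY H).
have sP : map_poly (spS S) P = ('X - (spS S (spE S t0))%:P) * H'.
  have /= -> := @sp_SE _ _ _ _ _ S t0.
  rewrite PE map_polyZ /= sp_subst SE HE -[q *: H]mul_polyC rmorphM /= swapXY_polyC rmorphM /=.
  have -> : map_poly tofrac (map_poly polyC q) = (@embk k 1 cq)%:P * ('X - (@embk k 1 t0)%:P).
    have -> : map_poly tofrac (map_poly polyC q) = map_poly (@embk k 1) q by rewrite -map_poly_comp.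
    by rewrite qE [LHS]rmorphM; congr (_ * _); [exact: map_polyC | exact: map_polyXsubC].
  exact: scale_mulCA.
have u0 : spS S b * @embk k 1 cq != 0.
  apply: (mulf_neq0 b0); rewrite fmorph_eq0; exact: cq0.
have irrH' : irreducible_poly H'.
  by apply: irreducible_eqp irrH; rewrite eqp_sym eqp_scale.
have H'0 : H'.[spS S (spE S t0)] != 0.
  (* A root would force the irreducible [H'] to have degree 1, but its degree is at least 2. *)
  apply/negP => /eqP H'0; have := irrH'.2 ('X - (spS S (spE S t0))%:P).
  rewrite size_XsubC dvdp_XsubCl /root H'0 eqxx => /(_ isT isT)/eqp_size.
  rewrite size_XsubC size_scale // size_map_tofrac => sz2.
  by rewrite -sz2 in szH.
apply: (gal_two_transitive (@sp_inj _ _ _ _ _ S) (sp_val S) galoisL Pm (roots_uniq j) (rsP iP)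
  _ sP irrH' H'0).
by rewrite iP; apply: monic_gen_irreducible.
Qed.

Lemma roots_transposition (i : 'I_m) : exists x1 x2 (g : gal_of {:L}),
  [/\ [/\ x1 \in rs i, x2 \in rs i & x1 != x2], g x1 = x2 /\ g x2 = x1 &
      forall x, x \in all_roots -> x != x1 -> x != x2 -> g x = x].
Proof.
have [t0 [l [r [[t00 szl] ld Fl dFl Fjl]]]] := tangent_exists hchar hdeg hirr hnassoc hn3 hp i.
have [c [Psi [PsiE sepPsi Psi0]]] := tangent_pencil hchar hdeg hirr hnassoc hn3 hp szl ld Fl dFl Fjl.
set q := ('X - t0%:P) ^+ 2 in PsiE.
have szq : size q = 3 by rewrite size_exp_XsubC.
have qt0 : q.[t0] = 0 by rewrite horner_exp hornerXsubC subrr expr0n.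
pose f := l + c%:P * q.
have szcq : (size (c%:P * q)%R <= n)%N.
  by rewrite mul_polyC (leq_trans (size_scale_leq _ _)) // szq.
have szf : (size f <= n.+1)%N.
  by rewrite (leq_trans (size_polyD _ _)) // geq_max szl leqW.
have fn : f`_n = l`_n by rewrite coefD [(c%:P * q)`_n]nth_default // addr0.
have ft0 : f.[t0] = l.[t0] by rewrite hornerD hornerM qt0 mulr0 addr0.
have [S [pi [pi0 spi ker_pi order]]] := tangent_specialization szf.
have /choice[bP bPP] : forall j, exists bP : spR S * {poly spR S},
    [/\ bP.2 = bP.1 *: subst (spE S) (Fs j) (spF S), spS S bP.1 != 0, bP.2 \is monic &
       map_poly (spI S) bP.2 = M j].
  move=> j; have [|b [P [h1 h2 h3 h4]]] := sp_monic S (F0 j); last by exists (b, P).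
  by rewrite map_poly_id ?fn // ld.
pose b j := (bP j).1; pose P j := (bP j).2; pose Phi := \prod_j P j.
have Phim : Phi \is monic by apply: monic_prod => j _; case: (bPP j).
have PhiE : map_poly (in_alg L \o spI S) Phi = \prod_(x <- all_roots) ('X - x%:P).
  rewrite map_poly_comp -all_rootsE rmorph_prod; congr (map_poly _ _).
  by apply: eq_bigr => j _; case: (bPP j).
have spt0 : spS S (spE S t0) = t0 := @sp_SE _ _ _ _ _ S t0.
have sP j : map_poly (spS S) (P j) = spS S (b j) *: (Fs j).[f].
  rewrite /P; case: (bPP j) => -> _ _ _; rewrite map_polyZ /= sp_subst /subst.
  by congr (_ *: _.[_]); rewrite map_poly_id // => z _ /=; rewrite map_poly_id.
pose B := \prod_j b j.
have B0 : spS S B != 0.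
  by rewrite rmorph_prod; apply/prodf_neq0 => j _; case: (bPP j).
have sPhi : map_poly (spS S) Phi =
    ('X - (spS S (spE S t0))%:P) * ('X - (spS S (spE S t0))%:P) * (spS S B *: Psi).
  rewrite spt0 -expr2 -/q -scalerAr -PsiE rmorph_prod rmorph_prod -scaler_prod.
  by apply: eq_bigr => j _; rewrite /= sP.
have sepBPsi : separable_poly (spS S B *: Psi).
  by move: sepPsi; rewrite unlock derivZ coprimepZl // coprimepZr.
have BPsi0 : (spS S B *: Psi).[spS S (spE S t0)] != 0 by rewrite spt0 hornerZ mulf_neq0.
pose F := \prod_j Fs j.
have evF : map_poly (horner_eval t0) F = map_poly (horner_eval t0) (Fs i) *
    \prod_(j | j != i) map_poly (horner_eval t0) (Fs j).
  by rewrite /F rmorph_prod (bigD1 i).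
have Fit0 : (map_poly (horner_eval t0) (Fs i)).[l.[t0]] = 0.
  by rewrite -ev_horner Fl hornerM horner_exp hornerXsubC subrr expr0n mul0r.
(* The value of [F(t0, f)] on the line, as a polynomial in [a_0]. Its zero is simple because the
   point is simple on [C] with nonvertical tangent. *)
pose pF := map_poly (horner_eval t0) F \Po ('X + (f.[t0] - f`_0)%:P).
have Xf : ('X + (f.[t0] - f`_0)%:P).[f`_0] = l.[t0].
  by rewrite hornerD hornerX hornerC addrC subrK ft0.
have /factor_theorem[p1 p1E] : root pF f`_0.
  by rewrite /root horner_comp Xf evF hornerM Fit0 mul0r.
have p10 : p1.[f`_0] != 0.
  have : pF^`().[f`_0] = p1.[f`_0].
    by rewrite p1E derivM derivXsubC mulr1 hornerD hornerM hornerXsubC subrr mulr0 add0r.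
  rewrite deriv_comp derivD derivX derivC addr0 mulr1 horner_comp Xf evF derivM.
  rewrite hornerD !hornerM Fit0 mul0r addr0 => <-; rewrite mulf_neq0 //.
    by rewrite deriv_map -ev_horner.
  rewrite horner_prod; apply/prodf_neq0 => j ji.
  by rewrite -ev_horner Fjl.
have [|d [dE sd]] := order F t0 p1; first by rewrite -/pF p1E mulrC.
have Phit0 : Phi.[spE S t0] = pi * (B * d).
  rewrite mulrCA -dE /F subst_prod !horner_prod -big_split; apply: eq_bigr => j _ /=.
  by rewrite /P; case: (bPP j) => -> _ _ _; rewrite hornerZ.
have d0 : spS S (B * d) != 0 by rewrite rmorphM mulf_neq0 // sd.
have sp_surj z : exists a, spS S a = z by exists (spE S z); apply: (@sp_SE _ _ _ _ _ S).
have [x1 [x2 [g [[x1r x2r x12] [gx1 gx2] gx info]]]] :=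
  inertia_transposition (@sp_inj _ _ _ _ _ S) (sp_val S) sp_surj spi ker_pi pi0 galoisL
    Phim all_roots_uniq PhiE gal_trivial Phit0 d0 sPhi sepBPsi BPsi0.
have [j x1j] := mem_all_roots _ x1r.
(* The residue of [x1] is [t0], and over [t0] the specialized [f] meets only the curve of [Fs i]. *)
have ji : j = i.
  have PjM : map_poly (spI S) (P j) = M j by case: (bPP j).
  apply/eqP; have := info (P j); rewrite (rsP PjM).
  rewrite root_prod_XsubC => /(_ x1j); rewrite sP spt0 rootZ; last by case: (bPP j).
  by apply: contraTT => /Fjl h; rewrite /root ev_horner ft0 -ev_horner.
rewrite ji in x1j; exists x1, x2, g; split=> //; split=> //.
by rewrite -gx1 -(perm_mem (gal_root_map g (rsE i) (roots_uniq i))) map_f.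
Qed.

(** The known transposition is conjugated by an element taking [x] and [y] to the roots it
    exchanges. *)
Lemma roots_swap (i : 'I_m) x y : x \in rs i -> y \in rs i -> x != y ->
  exists g : gal_of {:L}, [/\ g x = y, g y = x &
    forall z, z \in all_roots -> z != x -> z != y -> g z = z].
Proof.
move=> xr yr xy; have [x1 [x2 [g [[x1r x2r x12] [gx1 gx2] gz]]]] := roots_transposition i.
have [h _ [hx hy]] := roots_two_transitive xr yr x1r x2r xy x12.
have hV z : (h^-1)%g (h z) = z by rewrite -galM ?memvf // mulgV gal_id.
exists (h * g * h^-1)%g; split.
- by rewrite !galM ?memvf // hx gx1 -hy hV.
- by rewrite !galM ?memvf // hy gx2 -hx hV.
move=> z zr zx zy; rewrite !galM ?memvf // gz ?hV //.
- by rewrite -(perm_mem (gal_root_map h all_rootsE all_roots_uniq)) map_f.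
- by rewrite -hx (inj_eq (fmorph_inj h)).
by rewrite -hy (inj_eq (fmorph_inj h)).
Qed.

(** Induction on the number of moved points: composing [s] with the transposition of [a] and [s a],
    which lie in the same class, fixes [a] and moves no new point. *)
Lemma roots_permutation (T : finType) (tau : T -> L) (cl : T -> 'I_m) (s : {perm T}) :
    injective tau -> (forall u, tau u \in rs (cl u)) -> (forall u, cl (s u) = cl u) ->
  exists g : gal_of {:L}, forall u, g (tau u) = tau (s u).
Proof.
move=> tau_inj tau_r; have [N] := ubnP #|[set u | s u != u]|.
elim: N s => // N IH s ltN scl.
have [s1|] := set_0Vmem [set u | s u != u].
  exists 1%g => u; rewrite gal_id; congr tau.
  by have := in_set0 u; rewrite -s1 inE => /negbFE/eqP ->.
case=> a; rewrite inE => sa.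
pose s' := (s * tperm a (s a))%g.
have s'a : s' (a) = a by rewrite permM tpermR.
have [||g gs] := IH s'.
- rewrite -ltnS; apply: leq_trans ltN; rewrite ltnS; apply/proper_card/properP; split.
    apply/subsetP => u; rewrite !inE permM; apply: contraNneq => su.
    rewrite su; case: tpermP => // [ua|usa]; first by move: sa; rewrite -ua su eqxx.
    by move: sa; rewrite -(inj_eq (@perm_inj _ s)) -usa su eqxx.
  by exists a; rewrite !inE ?sa // s'a eqxx.
- move=> u; rewrite permM; case: tpermP => [su|su|_ _]; last exact: scl.
  + by rewrite scl -su scl.
  by rewrite -(scl a) -su scl.
have [h [h1 h2 h3]] : exists h : gal_of {:L}, [/\ h (tau a) = tau (s a), h (tau (s a)) = tau a &
    forall z, z \in all_roots -> z != tau a -> z != tau (s a) -> h z = z].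
  have sar : tau (s a) \in rs (cl a) by rewrite -(scl a); apply: tau_r.
  have ta : tau a != tau (s a) by rewrite (inj_eq tau_inj) eq_sym.
  exact: roots_swap (tau_r a) sar ta.
exists (g * h)%g => u; rewrite galM ?memvf // gs /s' permM.
have [sua|sua] := eqVneq (s u) a; first by rewrite sua tpermL h2.
have [sus|sus] := eqVneq (s u) (s a); first by rewrite sus tpermR h1.
rewrite tpermD 1?eq_sym //.
apply: h3; rewrite ?(inj_eq tau_inj) //.
by apply/mem_all_roots; exists (cl (s u)).
Qed.
End Main.

Lemma splitting_roots (k : closedFieldType) (m n : nat) (Fs : 'I_m -> {poly {poly k}})
    (L : splittingFieldType (ratT k n.+1)) : (forall i, Fs i != 0) ->
    splittingFieldFor 1%VS (map_poly (in_alg L) (subst_gen n (\prod_(i < m) Fs i))) fullv ->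
  exists rs : 'I_m -> seq L,
    (forall i, map_poly (in_alg L) (monic_gen n (Fs i)) = \prod_(x <- rs i) ('X - x%:P)) /\
    <<1 & all_roots rs>>%VS = fullv.
Proof.
move=> F0 [r rE rspan].
have totE : map_poly (in_alg L) (\prod_i monic_gen n (Fs i)) %=
    map_poly (in_alg L) (subst_gen n (\prod_i Fs i)).
  rewrite eqp_map subst_genE subst_prod.
  apply: (big_ind2 (fun P Q : {poly ratT k n.+1} => P %= Q)); first exact: eqpxx.
    by move=> P1 P2 Q1 Q2 /andP[h1 h1'] /andP[h2 h2']; rewrite /eqp !dvdp_mul.
  by move=> i _; rewrite -subst_genE monic_gen_eqp.
have /choice[rs rsE] : forall i, exists s : seq L,
    map_poly (in_alg L) (monic_gen n (Fs i)) = \prod_(x <- s) ('X - x%:P).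
  move=> i; have : map_poly (in_alg L) (monic_gen n (Fs i)) %| \prod_(x <- r) ('X - x%:P).
    rewrite -(eqp_dvdr _ rE) -(eqp_dvdr _ totE) dvdp_map (bigD1 i) //=.
    by apply: dvdp_mulr.
  case/dvdp_prod_XsubC => s; rewrite eqp_monic ?monic_prod_XsubC ?monic_map ?monic_gen_monic //.
  by move=> /eqP ->; exists (mask s r).
exists rs; split=> //; apply/eqP; rewrite eqEsubv subvf -rspan.
apply: adjoin_seqSr => x; rewrite -(root_prod_XsubC (all_roots rs)) -(all_rootsE rsE).
by rewrite (eqp_root totE) (eqp_root rE) root_prod_XsubC.
Qed.

Theorem theorem2p5
  (p : nat) (hp : prime p)
  (k : closedFieldType) (hchar : p \in [pchar k])
  (halg : algebraic_over_prime_field k)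
  (m : nat) (Fs : 'I_m -> {poly {poly k}})
  (hdeg : forall i, (1 < size (Fs i))%N)
  (hirr : forall i, irreducible_elt (Fs i))
  (hsep : forall i, sep_in_x p (Fs i))
  (hnassoc : forall i j, i != j -> ~ associated (Fs i) (Fs j))
  (n : nat) (hn3 : (3 <= n)%N)
  (hsing : exists2 s : seq (k * k), uniq s &
     (forall P : k * k, P \in s <->
        (eval2 (\prod_(i < m) Fs i) P.1 P.2 = 0 /\
         (2 < mult (\prod_(i < m) Fs i) P.1 P.2)%N)) /\ (size s < n)%N)
  (hp_large : forall i, ((size (subst_gen n (Fs i))).-1 < p)%N)
  (L : splittingFieldType (ratT k n.+1))
  (hL : splittingFieldFor 1%VS
          (map_poly (in_alg L) (subst_gen n (\prod_(i < m) Fs i))) fullv) :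
  exists rs : forall i : 'I_m, seq L,
    (forall i, [/\ uniq (rs i), size (rs i) = (size (subst_gen n (Fs i))).-1 &
       forall x : L, root (map_poly (in_alg L) (subst_gen n (Fs i))) x = (x \in rs i)])
    /\
    forall s : forall i : 'I_m, 'S_((size (subst_gen n (Fs i))).-1),
      exists2 g, g \in 'Gal(fullv / 1%VS)%g &
        forall (i : 'I_m) (j : 'I_((size (subst_gen n (Fs i))).-1)),
          g (nth 0 (rs i) j) = nth 0 (rs i) (s i j).
Proof.
have F0 i : Fs i != 0 by have [] := hirr i.
have hp' i : (tdeg n (Fs i) < p)%N by have := hp_large i; rewrite size_subst_gen.
have [rs [rsE rspan]] := splitting_roots F0 hL.
have urs := roots_uniq hchar hdeg hirr hnassoc hn3 hp' rsE.
have szrs i : size (rs i) = (size (subst_gen n (Fs i))).-1.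
  rewrite -(eqp_size (monic_gen_eqp n (F0 i))) -(size_map_poly (in_alg L)) rsE.
  by rewrite size_prod_XsubC.
exists rs; split=> [i|s].
  split=> // x; have eM : map_poly (in_alg L) (monic_gen n (Fs i)) %=
      map_poly (in_alg L) (subst_gen n (Fs i)) by rewrite eqp_map monic_gen_eqp.
  by rewrite -(eqp_root eM) rsE root_prod_XsubC.
(* The permutations [s i] are assembled into a single permutation of the disjoint union of the index
   sets, which [tau] embeds in the set of all roots. *)
pose T := {i : 'I_m & 'I_((size (subst_gen n (Fs i))).-1)}.
pose mkT i (j : 'I_((size (subst_gen n (Fs i))).-1)) : T := existT _ i j.
pose f (u : T) : T := mkT _ (s (tag u) (tagged u)).
have f_inj : injective f.
  move=> [i j] [i' j'] /= h; have := congr1 tag h; rewrite /= => ii'.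
  case: _ / ii' j' h => j' /eqP; rewrite eq_Tagged /= => /eqP/perm_inj ->.
  by [].
pose tau (u : T) := nth 0 (rs (tag u)) (tagged u).
have tau_r u : tau u \in rs (tag u) by rewrite mem_nth // szrs.
have tau_inj : injective tau.
  move=> [i j] [i' j'] /= h; have := tau_r (mkT _ j').
  rewrite -h => xi'; have ii' : i = i' := roots_disjoint hchar hdeg hirr hnassoc hn3 hp' rsE (tau_r (mkT _ j)) xi'.
  move: h; rewrite /tau /=; case: _ / ii' j' xi' => j' _ /eqP; rewrite nth_uniq ?szrs // => /eqP/val_inj ->.
  by [].
have [|g gE] := roots_permutation hchar hdeg hirr hnassoc hn3 hp' rsE rspan
  (s := perm f_inj) tau_inj tau_r.
  by move=> u; rewrite permE.
exists g; first exact: gal_all.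
by move=> i j; have := gE (mkT _ j); rewrite permE.
Qed.
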